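(* Let $(P^N)_{N\ge1}$ be a sequence with $P^N\in\mathcal M^{np,N}$, let $(Y_1^N,\dots,Y_N^N)\sim P^N$ and $P_N=\delta_{(Y_1^N,\dots,Y_N^N)}\in\mathcal M^{np,N}$. Suppose: (1) $g\notin\mathrm{Span}\{1,t_1^N,\dots,t^N_{\tilde L^N}\}$ for every $N$; (2) (stabilizing design) there are $N_0\ge1$ and $a_1,\dots,a_M$ with $\{a_1^N,\dots,a_N^N\}=\{a_1,\dots,a_M\}$ for all $N\ge N_0$, and for every $a\in\{a_1,\dots,a_M\}$ there is $e(a)>0$ with $e^N(a)\to e(a)$ as $N\to\infty$; (3) there exist $N_1\ge N_0$, $b\in\mathbb R^{\tilde L}$, $\lambda\in\mathbb R^{\tilde L}$ such that for every $N\ge N_1$ for which $\mathrm{Dual}(P^N)$ admits a unique minimizer $(\lambda(P^N),\nu(P^N))$, one has $b^N(P^N)=b$ and $\lambda(P^N)=\lambda$; (4) there exist $N_2\ge1$ and $\eta>0$ such that for every $N\ge N_2$, if $\mathrm{Dual}(P^N)$ admits a unique minimizer $(\lambda(P^N),\nu(P^N))$, then for every $\bar P^N\in\mathcal M^{np,N}$ with $\|b^N(\bar P^N)-b^N(P^N)\|<\eta$: $\mathrm{Dual}(\bar P^N)$ admits a unique minimizer $(\lambda(\bar P^N),\nu(\bar P^N))$, $\tilde\Psi^{+,N}(\bar P^N)-\tilde\Psi^{+,N}(P^N)=\lambda(\bar P^N)^\top\{b^N(\bar P^N)-b^N(P^N)\}$, and $\lambda(\bar P^N)=\lambda(P^N)$;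 (5) with $b,\lambda$ as in (3), $$\sum_{a\in\{a_1,\dots,a_M\}}\frac1{e(a)}\Big[\sum_{l\in[\tilde L]:a(l)=a}b_l\lambda_l^2-\Big\{\sum_{l\in[\tilde L]:a(l)=a}b_l\lambda_l\Big\}^2\Big]>0;$$ (6) there is $N_3\ge1$ such that for every $N\ge N_3$, $P^N$ is realizable under $(\mathcal Q_\beta,s)$ and nondegenerate. Then $$\sqrt N\,\frac{\tilde\Psi^{+,N}(P_N)-\Psi^{+,N}(P^N)}{\sigma_N(P_N)}\ \xrightarrow{d}\ \mathcal N(0,1)\qquad\text{as }N\to\infty .$$
   Context: Write $[m]=\{1,\dots,m\}$. Let $J,T\ge 1$ be integers and $\mathcal A_T=\{A_1\times\cdots\times A_T: \varnothing\neq A_t\subseteq[J]\}$. For each integer $N\ge1$ fix a design $a_1^N,\dots,a_N^N\in\mathcal A_T$, let $\mathcal Y^N=a_1^N\times\cdots\times a_N^N$ and let $\mathcal M^{np,N}$ be the set of all probability measures on the finite set $\mathcal Y^N$. Let $(\mathcal B,\mathscr B)$ be a measurable space and $\mathcal Q_\beta$ the set of all probability measures on it. A choice kernel is a measurable map $s:\mathcal B\times\mathcal A_T\times[J]^T\to[0,1]$ (discrete $\sigma$-algebras on the finite factors) with $s(\beta,a,y)=0$ if $y\notin a$ and $\sum_{y\in a}s(\beta,a,y)=1$ for all $(\beta,a)$; fix one. For $Q_\beta\in\mathcal Q_\beta$, $P^{F,s,N}(Q_\beta)$ is the law of pairs $(\beta_i,Y_i)_{i\in[N]}$, independent across $i$,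 with $\beta_i\sim Q_\beta$ and $\mathbb P(Y_i=y\mid\beta_i)=s(\beta_i,a_i^N,y)$; $M_{\mathcal Y^N}$ maps such a law to the marginal law of $(Y_1,\dots,Y_N)$, so $M_{\mathcal Y^N}(P^{F,s,N}(Q_\beta))(y_1,\dots,y_N)=\prod_{i=1}^N\int_{\mathcal B} s(\beta,a_i^N,y_i)\,dQ_\beta(\beta)$. $P^N\in\mathcal M^{np,N}$ is realizable under $(\mathcal Q_\beta,s)$ if $P^N=M_{\mathcal Y^N}(P^{F,s,N}(Q_\beta))$ for some $Q_\beta\in\mathcal Q_\beta$. Let $g:\mathcal B\to[0,1]$ be measurable and $\Psi^{+,N}(P^N)=\sup\{\int g\,dQ_\beta: Q_\beta\in\mathcal Q_\beta,\ M_{\mathcal Y^N}(P^{F,s,N}(Q_\beta))=P^N\}$. Let $\mathcal D^N=\{(a,y):a\in\{a_1^N,\dots,a_N^N\},y\in a\}$, $n_a=\#\{i\in[N]:a_i^N=a\}$, $e^N(a)=n_a/N$, and for $P\in\mathcal M^{np,N}$ let $Q^{np,N}_{Y\mid a}(P)(a,y)=\frac1{n_a}\sum_{i:a_i^N=a}P_i(y)$ where $P_i$ is the $i$-th marginal of $P$. Let $L^N=\#\mathcal D^N$, let $(a(l),y(l))_{l\in[L^N]}$ be an ordering of $\mathcal D^N$, $t_l^N(\beta)=s(\beta,a(l),y(l))$. Let $\tilde L^N+1$ be the maximal cardinality of a linearly independent subset of the functions $\{1,t_1^N,\dots,t^N_{L^N}\}$, with the ordering chosen so that $1,t_1^N,\dots,t^N_{\tilde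 L^N}$ is such a subset. Put $t^N=(t_1^N,\dots,t^N_{\tilde L^N})^\top$ and $b^N(P)=(Q^{np,N}_{Y\mid a}(P)(a(l),y(l)))_{l=1}^{\tilde L^N}$. Under the stabilizing design condition (2), the ordering and the nonredundant subset are chosen to be the same for all $N\ge N_0$, so $L^N=L$, $\tilde L^N=\tilde L$, $t_l^N=t_l$ for $N\ge N_0$. $\mathrm{Primal}(P)$: $\sup_{Q_\beta\in\mathcal Q_\beta}\int g\,dQ_\beta$ subject to $\int t_l^N\,dQ_\beta=b_l^N(P)$ for all $l\in[\tilde L^N]$; its value is $\tilde\Psi^{+,N}(P)$. $\mathrm{Dual}(P)$: $\inf_{\lambda\in\mathbb R^{\tilde L^N},\nu\in\mathbb R}\lambda^\top b^N(P)+\nu$ subject to $\lambda^\top t^N(\beta)+\nu\ge g(\beta)$ for all $\beta\in\mathcal B$. $P$ is nondegenerate if $\mathrm{Primal}(P)$ admits a maximizer $Q=\sum_{l=1}^{\tilde L^N+1}Q_l\delta_{\beta_l}$ with all $Q_l>0$, $\sum_lQ_l=1$, $\beta_l\in\mathcal B$, such that the $(\tilde L^N+1)\times(\tilde L^N+1)$ matrix whose $l$-th row, $l\le\tilde L^N$, is $(t_l^N(\beta_k))_{k=1}^{\tilde L^N+1}$ and whose last row is $(1,\dots,1)$ has full rank. For $P\in\mathcal M^{np,N}$ such that $\mathrm{Dual}(P)$ has a unique minimizer $(\lambda(P),\nu(P))$, $\sigma_N(P)=\sqrt{\sigma_N^2(P)}$ with $$\sigma_N^2(P)=\sum_{a\in\{a_1^N,\dots,a_N^N\}}\frac1{e^N(a)}\Big[\sum_{l\in[\tilde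 L^N]:a(l)=a}b_l^N(P)\lambda_l(P)^2-\Big\{\sum_{l\in[\tilde L^N]:a(l)=a}b_l^N(P)\lambda_l(P)\Big\}^2\Big].$$ If $\mathrm{Dual}(P)$ does not admit a unique minimizer, $\sigma_N^2(P)=1$. The ratio in the conclusion is assigned an arbitrary value (e.g. $0$) where it is not a well-defined real number. *)

(* Defs.v *)
From HB Require Import structures.
From mathcomp Require Import all_boot all_order all_algebra.
From mathcomp Require Import all_classical all_reals all_analysis.
From mathcomp Require Import measurable_realfun giry.

Set Implicit Arguments.
Unset Strict Implicit.
Unset Printing Implicit Defensive.

Import Order.TTheory GRing.Theory Num.Theory.
Import numFieldNormedType.Exports.

Local Open Scope classical_set_scope.
Local Open Scope ring_scope.

(* J.+1 alternatives and T.+1 periods: both numbers are at least 1. *)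
Definition choice_path (J T : nat) := {ffun 'I_T.+1 -> 'I_J.+1}.

HB.instance Definition _ J T := Finite.on (choice_path J T).
HB.instance Definition _ J T := isPointed.Build (choice_path J T) [ffun=> ord0].
HB.instance Definition _ J T := @isMeasurable.Build default_measure_display
  (choice_path J T) discrete_measurable discrete_measurable0
  discrete_measurableC discrete_measurableU.

Definition menus (J T : nat) : {set {set choice_path J T}} :=
  [set [set y : choice_path J T | [forall t, y t \in A t]]%SET
    | A : {ffun 'I_T.+1 -> {set 'I_J.+1}} & [forall t, A t != finset.set0]]%SET.

Definition menu (J T : nat) := {m : {set choice_path J T} | m \in menus J T}.

Definition menu_set J T (a : menu J T) : {set choice_path J T} := sval a.

Lemma setT_menus J T : [set: choice_path J T]%SET \in menus J T.
Proof.
apply/imsetP; exists [ffun=> finset.setT].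
  by rewrite inE; apply/forallP => t; rewrite ffunE; apply/set0Pn; exists ord0.
by apply/setP => y; rewrite !inE; apply/esym/forallP => t; rewrite ffunE inE.
Qed.

HB.instance Definition _ J T := Finite.on (menu J T).
HB.instance Definition _ J T :=
  isPointed.Build (menu J T)
    (exist (fun m => m \in menus J T) _ (setT_menus J T)).
HB.instance Definition _ J T := @isMeasurable.Build default_measure_display
  (menu J T) discrete_measurable discrete_measurable0
  discrete_measurableC discrete_measurableU.

Record choice_kernel (R : realType) d (B : measurableType d) (J T : nat) :=
  ChoiceKernel {
  kernel_prob :> B -> menu J T -> choice_path J T -> R ;
  kernel_measurable :
    measurable_fun [set: B * menu J T * choice_path J T]
      (fun x => kernel_prob x.1.1 x.1.2 x.2) ;
  kernel_itv : forall beta a y, 0 <= kernel_prob beta a y <= 1 ;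
  kernel_off : forall beta (a : menu J T) y, y \notin menu_set a -> kernel_prob beta a y = 0 ;
  kernel_sum1 : forall beta (a : menu J T), \sum_(y in menu_set a) kernel_prob beta a y = 1
}.

Lemma measurable_kernel_prob (R : realType) d (B : measurableType d) (J T : nat)
    (s : choice_kernel R B J T) a y :
  measurable_fun [set: B] (fun beta => s beta a y).
Proof.
apply: (measurableT_comp (@kernel_measurable _ _ _ _ _ s)
  (g := fun beta => (beta, a, y))).
by apply: measurable_fun_pair => //; apply: measurable_fun_pair.
Qed.

(* The law of (beta, Y) with beta ~ Q and P(Y = y | beta) = s(beta, a, y). *)
Definition pair_law (R : realType) d (B : measurableType d) (J T : nat)
    (s : choice_kernel R B J T) (Q : probability B R) (a : menu J T) :
    set (B * choice_path J T) -> \bar R :=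
  fun A => (\sum_(y : choice_path J T)
              \int[Q]_(beta in ysection A y) (s beta a y)%:E)%E.

Section pair_law_probability.
Context (R : realType) d (B : measurableType d) (J T : nat).
Variables (s : choice_kernel R B J T) (Q : probability B R) (a : menu J T).
Local Open Scope ereal_scope.

Let mu : set (B * choice_path J T) -> \bar R := pair_law s Q a.

Let s_ge0 beta y : 0 <= (s beta a y)%:E.
Proof. by rewrite lee_fin; have /andP[] := kernel_itv s beta a y. Qed.

Let ms D y : measurable_fun D (EFin \o (fun beta => s beta a y)).
Proof.
by apply/measurable_EFinP; apply: measurable_funTS; exact: measurable_kernel_prob.
Qed.

Let pair_law0 : mu set0 = 0.
Proof.
by rewrite /mu /pair_law big1// => y _; rewrite ysection0 integral_set0.
Qed.

Let pair_law_ge0 A : 0 <= mu A.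
Proof. by apply: sume_ge0 => y _; exact: integral_ge0. Qed.

Let pair_law_sigma_additive : semi_sigma_additive mu.
Proof.
move=> F mF tF mUF; rewrite /mu /pair_law.
under eq_fun do rewrite exchange_big /=.
apply: cvg_nnesum => y _.
  by near=> n; apply: sume_ge0 => i _; exact: integral_ge0.
rewrite ysection_bigcup ge0_integral_bigcup//.
- apply: is_cvg_ereal_nneg_natsum => n _; exact: integral_ge0.
- by move=> k; exact: measurable_ysection.
- exact: ms.
- exact: trivIset_ysection.
Unshelve. all: by end_near. Qed.

HB.instance Definition _ := isMeasure.Build _ _ _
  (pair_law s Q a) pair_law0 pair_law_ge0 pair_law_sigma_additive.

Let pair_law_setT : mu setT = 1.
Proof.
rewrite /mu /pair_law.
transitivity (\sum_(y : choice_path J T) \int[Q]_beta (s beta a y)%:E).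
  by apply: eq_bigr => y _; rewrite ysectionE preimage_setT.
rewrite -ge0_integral_sum//; last by move=> y; exact: ms.
rewrite (eq_integral (cst 1)) => [|beta _].
  by rewrite integral_cst// mul1e; exact: (probability_setT Q).
rewrite /= sumEFin -(kernel_sum1 s beta a); congr EFin.
by rewrite [RHS]big_mkcond; apply: eq_bigr => y _; case: ifPn => // /kernel_off ->.
Qed.

HB.instance Definition _ := Measure_isProbability.Build _ _ _
  (pair_law s Q a) pair_law_setT.

End pair_law_probability.

Section product_probability.
Context d (X : measurableType d) (R : realType).

Definition cons_pair n (x : X * n.-tuple X) : n.+1.-tuple X :=
  [tuple of x.1 :: x.2].

Lemma measurable_cons_pair n : measurable_fun setT (@cons_pair n).
Proof. by apply: measurable_cons. Qed.

HB.instance Definition _ n := isMeasurableFun.Build _ _ _ _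
  (@cons_pair n) (@measurable_cons_pair n).

(* The law of an n-tuple of independent entries, the i-th one of law p i. *)
Fixpoint prod_probability n :
    ('I_n -> probability X R) -> probability (n.-tuple X) R :=
  match n with
  | 0 => fun=> dirac [tuple]
  | m.+1 => fun p => distribution
      (p ord0 \x prod_probability (fun i => p (lift ord0 i)))%E (@cons_pair m)
  end.

Lemma measurable_box n (A : 'I_n -> set X) : (forall i, measurable (A i)) ->
  measurable [set x : n.-tuple X | forall i, A i (tnth x i)].
Proof.
move=> mA.
rewrite (_ : [set _ | _] = \bigcap_(i in [set: 'I_n]) (@tnth _ X ^~ i @^-1` A i)).
  apply: fin_bigcap_measurable => // i _; rewrite -[X in measurable X]setTI.
  exact: measurable_tnth.
by apply/seteqP; split => x /= H i => [_|]; apply: H.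
Qed.

Lemma prod_probability_box n (p : 'I_n -> probability X R) (A : 'I_n -> set X) :
  (forall i, measurable (A i)) ->
  (prod_probability p [set x | forall i, A i (tnth x i)] = \prod_i p i (A i))%E.
Proof.
elim: n p A => [|n IH] p A mA /=.
  rewrite big_ord0 diracE mem_set// => -[]//.
rewrite big_ord_recl -IH; last by move=> i; exact: mA.
set p' := fun i : 'I_n => p (lift ord0 i); set A' := fun i : 'I_n => A (lift ord0 i).
have mA' : measurable [set x : n.-tuple X | forall i, A' i (tnth x i)].
  by apply: measurable_box => i; exact: mA.
rewrite -(product_measure1E (p ord0) (prod_probability p') (mA ord0) mA').
congr (_ _); apply/seteqP; split => [[x t]/= H|[x t]/= [H0 H] i].
  by split => [|i]; [have := H ord0|have := H (lift ord0 i); rewrite tnthS].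
have [->//|i0] := eqVneq i ord0.
have [j ->] : exists j, i = lift ord0 j.
  by case: (unliftP ord0 i) i0 => [j ->|->]; [exists j|rewrite eqxx].
by rewrite tnthS; exact: H.
Qed.

End product_probability.

Notation profile J T N := (N.-tuple (choice_path J T)).

Section model.
Context (R : realType) d (B : measurableType d) (J T : nat).
Variables (s : choice_kernel R B J T) (g : B -> R).

Definition design (N : nat) := 'I_N -> menu J T.

Lemma measurable_profile N (A : set (profile J T N)) : measurable A.
Proof.
rewrite (_ : A = \bigcup_(y in A) [set y]); last first.
  apply/seteqP; split => [y Ay|y [z Az ->]//].
  by exists y.
apply: fin_bigcup_measurable => [|y _]; first exact: finite_finset.
rewrite (_ : [set y] = [set x | forall i, [set tnth y i] (tnth x i)]); last first.
  apply/seteqP; split => [x ->//|x /= H].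
  by apply: eq_from_tnth => i; exact: H.
by apply: (@measurable_box _ _ N (fun i => [set tnth y i])) => i.
Qed.

Definition choice_part N (x : N.-tuple (B * choice_path J T)) :
  profile J T N := map_tuple snd x.

Lemma measurable_choice_part N : measurable_fun setT (@choice_part N).
Proof.
apply/measurable_fun_tnthP => i.
rewrite (_ : _ \o _ = snd \o (@tnth N _ ^~ i)); last first.
  by apply/funext => x /=; rewrite tnth_map.
apply: measurableT_comp; first exact: measurable_snd.
exact: measurable_tnth.
Qed.

HB.instance Definition _ N := isMeasurableFun.Build _ _ _ _
  (@choice_part N) (@measurable_choice_part N).

Definition full_law N (a : design N) (Q : probability B R) :
    probability (N.-tuple (B * choice_path J T)) R :=
  prod_probability (fun i => pair_law s Q (a i)).

Definition marginal_choices N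
    (F : probability (N.-tuple (B * choice_path J T)) R) :
    probability (profile J T N) R :=
  distribution F (@choice_part N).

Lemma marginal_full_lawE N (a : design N) Q (y : profile J T N) :
  (marginal_choices (full_law a Q) [set y] =
   \prod_(i < N) \int[Q]_beta (s beta (a i) (tnth y i))%:E)%E.
Proof.
rewrite /marginal_choices /full_law /= /distribution /pushforward.
rewrite (_ : _ @^-1` _ =
    [set x | forall i, (setT `*` [set tnth y i]) (tnth x i)]); last first.
  apply/seteqP; split => [x /= <- i|x /= H]; first by rewrite tnth_map.
  by apply: eq_from_tnth => i; rewrite tnth_map; have [] := H i.
have mA i : measurable ([set: B] `*` [set tnth y i]) by exact: measurableX.
apply: (etrans (prod_probability_box _ mA)).
apply: eq_bigr => i _ /=; rewrite /pair_law (bigD1 (tnth y i))//=.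
rewrite in_ysectionX ?inE// big1 ?adde0// => z zy.
rewrite notin_ysectionX ?integral_set0// notin_setE /= => zyE.
by rewrite zyE eqxx in zy.
Qed.

Definition design_menus N (a : design N) : {set menu J T} := [set a i | i : 'I_N]%SET.

Definition menu_count N (a : design N) (m : menu J T) : nat := #|[set i | a i == m]%SET|.

Definition menu_freq N (a : design N) (m : menu J T) : R :=
  (menu_count a m)%:R / N%:R.

(* A probability measure on the finite set a_1 x ... x a_N is represented by the
   probability measure on all profiles that gives this set mass 1. *)
Definition np_model N (a : design N) : set (probability (profile J T N) R) :=
  [set P | P [set y | forall i, tnth y i \in menu_set (a i)] = 1%E].

Definition realizable N (a : design N) (P : probability (profile J T N) R) : Prop :=
  exists Q : probability B R, measure_eq P (marginal_choices (full_law a Q)).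

Definition Psi_sup N (a : design N) (P : probability (profile J T N) R) : \bar R :=
  ereal_sup [set (\int[Q]_beta (g beta)%:E)%E | Q in
    [set Q : probability B R | measure_eq (marginal_choices (full_law a Q)) P]].

Definition margin N (P : probability (profile J T N) R) (i : 'I_N)
    (y : choice_path J T) : R :=
  fine (P [set z | tnth z i = y]).

Definition choice_freq N (a : design N) (P : probability (profile J T N) R)
    (m : menu J T) (y : choice_path J T) : R :=
  (menu_count a m)%:R^-1 * \sum_(i < N | a i == m) margin P i y.

Definition cell := (menu J T * choice_path J T)%type.

Definition cells N (a : design N) : {set cell} :=
  [set c : cell | (c.1 \in design_menus a) && (c.2 \in menu_set c.1)]%SET.

(* An ordering of the cells is a sequence o; its l-th entry, counted from 0, is
   (a(l), y(l)), and vectors are indexed by the positions of the first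
   nonredundant cells. *)
Definition cell_at (o : seq cell) (l : nat) : cell := nth (point, point) o l.

Definition t_fun (o : seq cell) (l : nat) (beta : B) : R :=
  s beta (cell_at o l).1 (cell_at o l).2.

(* The family 1, t_1, ..., t_L, with None the index of the constant 1. *)
Definition moment_fun (o : seq cell) (k : option 'I_(size o)) : B -> R :=
  if k is Some l then t_fun o l else cst 1.

Definition lin_indep (I : finType) (f : I -> B -> R) (S : {set I}) : Prop :=
  forall c : I -> R, (forall beta, \sum_(k in S) c k * f k beta = 0) ->
    forall k, k \in S -> c k = 0.

(* Cardinality is counted on index sets, which is the same as counting functions:
   the members of an independent family are pairwise distinct. *)
Definition max_indep (o : seq cell) : nat :=
  \max_(S : {set option 'I_(size o)} | `[< lin_indep (@moment_fun o) S >]) #|S|.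

Definition ndim (o : seq cell) : nat := (max_indep o).-1.

Definition admissible_ordering N (a : design N) (o : seq cell) : Prop :=
  [/\ uniq o, o =i cells a &
      lin_indep (@moment_fun o)
        [set k : option 'I_(size o) | if k is Some l then (l < ndim o)%N else true]%SET].

Definition dotv n (u v : 'rV[R]_n) : R := \sum_(l < n) u 0 l * v 0 l.

Definition enorm n (u : 'rV[R]_n) : R := Num.sqrt (dotv u u).

Definition affine_comb (o : seq cell) (p : 'rV[R]_(ndim o) * R) (beta : B) : R :=
  \sum_(l < ndim o) p.1 0 l * t_fun o l beta + p.2.

Definition in_span (o : seq cell) (f : B -> R) : Prop :=
  exists p : 'rV[R]_(ndim o) * R, f = affine_comb p.

Definition bvec N (a : design N) (o : seq cell) (P : probability (profile J T N) R) :
    'rV[R]_(ndim o) :=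
  \row_(l < ndim o) choice_freq a P (cell_at o l).1 (cell_at o l).2.

Definition primal_feasible (o : seq cell) (b : 'rV[R]_(ndim o)) :
    set (probability B R) :=
  [set Q | forall l : 'I_(ndim o), (\int[Q]_beta (t_fun o l beta)%:E = (b 0 l)%:E)%E].

Definition primal_value N (a : design N) (o : seq cell)
    (P : probability (profile J T N) R) : \bar R :=
  ereal_sup [set (\int[Q]_beta (g beta)%:E)%E | Q in primal_feasible (bvec a o P)].

Definition dual_feasible (o : seq cell) : set ('rV[R]_(ndim o) * R) :=
  [set p | forall beta, g beta <= affine_comb p beta].

Definition dual_minimizer N (a : design N) (o : seq cell)
    (P : probability (profile J T N) R) : set ('rV[R]_(ndim o) * R) :=
  [set p | dual_feasible p /\
    forall q, dual_feasible q ->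
      dotv p.1 (bvec a o P) + p.2 <= dotv q.1 (bvec a o P) + q.2].

Definition unique_dual_minimizer N (a : design N) (o : seq cell)
    (P : probability (profile J T N) R) : set ('rV[R]_(ndim o) * R) :=
  [set p | dual_minimizer a P p /\ forall q, dual_minimizer a P q -> q = p].

Definition nondegenerate_law N (a : design N) (o : seq cell)
    (P : probability (profile J T N) R) : Prop :=
  exists (Q : probability B R) (q : 'I_(ndim o + 1) -> R) (x : 'I_(ndim o + 1) -> B),
    [/\ primal_feasible (bvec a o P) Q,
        forall Q', primal_feasible (bvec a o P) Q' ->
          (\int[Q']_beta (g beta)%:E <= \int[Q]_beta (g beta)%:E)%E,
        (forall l, 0 < q l) /\ \sum_l q l = 1,
        forall A, measurable A -> (Q A = \sum_l (q l)%:E * \d_(x l) A)%E &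
        \rank (col_mx (\matrix_(l < ndim o, k < ndim o + 1) t_fun o l (x k))
                      (const_mx 1 : 'rV[R]_(ndim o + 1))) = (ndim o + 1)%N].

Definition variance_sum (o : seq cell) (M : {set menu J T}) (e : menu J T -> R)
    (b lambda : 'rV[R]_(ndim o)) : R :=
  \sum_(m in M) (e m)^-1 *
    (\sum_(l < ndim o | (cell_at o l).1 == m) b 0 l * lambda 0 l ^+ 2
     - (\sum_(l < ndim o | (cell_at o l).1 == m) b 0 l * lambda 0 l) ^+ 2).

Definition sigma2 N (a : design N) (o : seq cell)
    (P : probability (profile J T N) R) : R :=
  if `[< exists p, @unique_dual_minimizer N a o P p >] then
    variance_sum (design_menus a) (menu_freq a) (bvec a o P)
      (xget (0, 0) (@unique_dual_minimizer N a o P)).1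
  else 1.

(* The studentized error at the data y, where the empirical law is the Dirac mass
   at y; r0 supplies the values where the ratio is not a real number. *)
Definition studentized N (a : design N) (o : seq cell)
    (P : probability (profile J T N) R) (r0 : profile J T N -> R)
    (y : profile J T N) : R :=
  let PN : probability (profile J T N) R := dirac y in
  let sigma := Num.sqrt (sigma2 a o PN) in
  if [&& primal_value a o PN \is a fin_num, Psi_sup a P \is a fin_num & sigma != 0]
  then Num.sqrt N%:R * ((fine (primal_value a o PN) - fine (Psi_sup a P)) / sigma)
  else r0 y.

Lemma measurable_studentized N (a : design N) (o : seq cell) P r0 :
  measurable_fun setT (@studentized N a o P r0).
Proof. by move=> _ A _; exact: measurable_profile. Qed.

HB.instance Definition _ N (a : design N) (o : seq cell) P r0 :=
  isMeasurableFun.Build _ _ _ _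
    (@studentized N a o P r0) (@measurable_studentized N a o P r0).

End model.

Arguments affine_comb {R d B J T} s o p beta.
Arguments primal_feasible {R d B J T} s o b.
Arguments dual_feasible {R d B J T} s g o.
Arguments dual_minimizer {R d B J T} s g {N} a o P.
Arguments unique_dual_minimizer {R d B J T} s g {N} a o P.
Arguments variance_sum {R d B J T} s o M e b lambda.

(* nu [set x] = 0 says that x is a continuity point of the limit c.d.f. *)
Definition cvg_in_distribution (R : realType)
    (mu : nat -> probability R R)
    (nu : probability (measurableTypeR R) R) : Prop :=
  forall x : R, nu [set x] = 0%E ->
    (mu N `]-oo, x]%classic @[N --> \oo] --> nu `]-oo, x]%classic)%E.

(* Main.v *)
(* Under nondegeneracy the dual minimizer is read off the support points of an optimal Q:
   the affine function of the moments interpolating g there is dual feasible, since a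
   violation at some beta would allow shifting mass to beta, and it is the only minimizer.
   Realizability makes the data independent, and the moments left out of the primal problem
   are affine in the retained ones, so Psi is the primal value. Near b the value is affine
   in b with slope lambda; by Chebyshev the empirical b lies there with probability tending
   to 1, so the studentized error is a normalized sum of independent bounded centered scores,
   up to a variance ratio tending to 1. The central limit theorem for this triangular array
   is proved by Stein's method: for a Lipschitz ramp h, the solution f of
   f'(x) - x f(x) = h(x) - E h(Z) has a derivative Lipschitz up to a quadratic weight, and
   E[f'(S) - S f(S)] is small for such sums S. *)
Require Import Defs.
From HB Require Import structures.
From mathcomp Require Import all_boot all_order all_algebra.
From mathcomp Require Import all_classical all_reals all_analysis.
From mathcomp Require Import measurable_realfun giry.
From mathcomp Require Import ring lra.

Set Implicit Arguments.
Unset Strict Implicit.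
Unset Printing Implicit Defensive.

Import Order.TTheory GRing.Theory Num.Theory.
Import numFieldNormedType.Exports.

Local Open Scope classical_set_scope.
Local Open Scope ring_scope.

(** * Stein equation *)

(** Since [P N] changes with N there is no fixed sequence of variables to pass to the limit in.
    Convergence comes instead from an inequality at each N whose constants depend only on x, the
    tolerance and the limiting quantities of the hypotheses. Choices are finitely many, so after
    realizability every probability is a finite weighted sum, and independence amounts to resampling
    one coordinate. The random denominator needs no Slutsky argument: while the empirical b is near
    b the slope is still [lambda], so the event that the ratio is at most x is exactly the event
    that one standardized sum is at most [x * rho], with rho close to 1. Monotonicity then leaves
    only the two deterministic thresholds x - |x| theta and x + |x| theta. Each individual facing a
    menu m enters the sum with weight 1/n_m, of order 1/N under the stabilizing design, so after
    standardization the summands are of order N^(-1/2), and the Stein error delta + N delta^3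
    vanishes. *)

Section stein_equation.
Context (R : realType).
Notation mu := (@lebesgue_measure R).
Local Notation phi := (@normal_pdf R 0 1).
Local Notation peak := (@normal_peak R 1).

Lemma std_normal_pdfE x : phi x = peak * expR (- x ^+ 2 / 2).
Proof. by rewrite normal_pdfE ?oner_neq0// /normal_fun subr0 expr1n. Qed.

Lemma std_normal_pdf_gt0 x : 0 < phi x.
Proof. by rewrite std_normal_pdfE mulr_gt0 ?expR_gt0 ?normal_peak_gt0 ?oner_neq0. Qed.

Lemma is_derive_std_normal_pdf (x : R) : is_derive x (1 : R) phi (- x * phi x).
Proof.
have -> : phi = (fun z => peak * expR (- z ^+ 2 / 2)).
  by apply/funext => z; exact: std_normal_pdfE.
apply: is_derive_eq.
by rewrite /GRing.scale /= ?expr1 ?scaler0; field.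
Qed.

(* A pointwise bound by a shifted normal density, whose total mass is 1; it replaces
   Mills-ratio estimates. *)
Lemma std_normal_pdf_tail x t : x * (x - t) <= 0 ->
  phi t <= peak^-1 * phi x * normal_pdf x 1 t.
Proof.
move=> xt; have p0 : 0 < peak by rewrite normal_peak_gt0 ?oner_neq0.
rewrite !std_normal_pdfE normal_pdfE ?oner_neq0// /normal_fun expr1n mulKf ?gt_eqF//.
rewrite mulrCA ler_pM2l// -expRD ler_expR.
(* Only the exponents are left to compare: t^2 - x^2 - (t - x)^2 = -2 x (x - t), which is
   nonnegative by hypothesis. *)
by rewrite -subr_ge0; have := xt; nra.
Qed.
Variables (h : R -> R) (K : R).
Hypothesis h_itv : forall x, 0 <= h x <= 1.
Hypothesis h_lip : forall x y, `|h x - h y| <= K * `|x - y|.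

Let h_continuous : continuous h.
Proof.
move=> x; apply/cvgrPdist_le => /= eps eps0.
have K0 : 0 <= K by have := h_lip 1 0; rewrite subr0 normr1 mulr1; exact: le_trans.
near=> t; apply: (le_trans (h_lip _ _)).
rewrite -(@ler_pM2l _ (K + 1)^-1) ?invr_gt0; last by lra.
apply: (@le_trans _ _ `|x - t|).
  by rewrite mulrA ler_piMl// mulrC ler_pdivrMr; lra.
near: t; apply: cvgr_dist_le; first exact: cvg_id.
by rewrite mulr_gt0// invr_gt0; lra.
Unshelve. all: by end_near. Qed.

Let c : R := \int[mu]_x (h x * phi x).
Let k x : R := (h x - c) * phi x.

Let measurable_h : measurable_fun setT h.
Proof. exact: continuous_measurable_fun. Qed.

Let integrable_phi : mu.-integrable setT (EFin \o phi).
Proof. exact: integrable_normal_pdf. Qed.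

Let integrable_hphi : mu.-integrable setT (EFin \o (fun x => h x * phi x)).
Proof.
apply: (le_integrable _ _ _ integrable_phi) => //.
  apply/measurable_EFinP; apply: measurable_funM => //.
  exact: measurable_normal_pdf.
move=> x _; rewrite /= lee_fin normrM ler_piMl//.
by have /andP[h0 h1] := h_itv x; rewrite ger0_norm.
Qed.

Let c_itv : 0 <= c <= 1.
Proof.
apply/andP; split.
  apply: Rintegral_ge0 => x _; rewrite mulr_ge0 ?normal_pdf_ge0//.
  by have /andP[] := h_itv x.
have -> : 1 = \int[mu]_x phi x by rewrite /Rintegral integral_normal_pdf.
apply: le_Rintegral => // x _.
by rewrite ler_piMl ?normal_pdf_ge0//; have /andP[] := h_itv x.
Qed.

Let hc_le1 x : `|h x - c| <= 1.
Proof. by have := h_itv x; have := c_itv; rewrite ler_norml; lra. Qed.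

Let k_le x : `|k x| <= phi x.
Proof. by rewrite normrM (ger0_norm (normal_pdf_ge0 _ _ _)) ler_piMl ?normal_pdf_ge0. Qed.

Let integrable_k : mu.-integrable setT (EFin \o k).
Proof.
apply: (le_integrable _ _ _ integrable_phi) => //.
  apply/measurable_EFinP; apply: measurable_funM => //.
    exact: measurable_funB.
  exact: measurable_normal_pdf.
by move=> x _; rewrite /= lee_fin (ger0_norm (normal_pdf_ge0 _ _ _)).
Qed.

(** Centering by [c] is what controls the right tail: for x > 0 the integral of [k] up to x is minus
    the integral beyond x, which is the small one. *)
Let integral_k : \int[mu]_x k x = 0.
Proof.
rewrite /k; under eq_Rintegral do rewrite mulrBl.
rewrite RintegralB//.
  rewrite RintegralZl// /c [X in _ - _ * X](_ : _ = 1) ?mulr1 ?subrr//.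
  by rewrite /Rintegral integral_normal_pdf.
rewrite (_ : _ \o _ = (fun x => c%:E * (EFin \o phi) x)%E); last exact/funext.
exact: integrableZl.
Qed.

Let k_continuous : continuous k.
Proof.
move=> x; apply: cvgM; last by apply: continuous_normal_pdf; rewrite oner_neq0.
by apply: cvgB; [exact: h_continuous|exact: cvg_cst].
Qed.

Let G x : R := \int[mu]_(t in `]-oo, x]) k t.

Let is_derive_G x : is_derive x (1 : R) G (k x).
Proof.
have [] : derivable G x 1 /\ derive1 G x = k x.
  apply: (@continuous_FTC1 _ k -oo%O x (x + 1)).
  - by rewrite ltrDl.
  - exact: integrableS integrable_k.
  - by rewrite ltNyr.
  - exact: k_continuous.
by move=> d <-; rewrite derive1E; exact: derivableP.
Qed.

(** The condition on [A] puts it beyond x as seen from 0, where |k| <= phi is dominated by a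
    multiple of the density centered at x. Enlarging the domain to the whole line is then
    affordable, since that density has mass 1. *)
Let tail_bound (A : set R) x : measurable A ->
  (forall t, A t -> x * (x - t) <= 0) -> `|\int[mu]_(t in A) k t| <= peak^-1 * phi x.
Proof.
move=> mA HA.
have ipdf : mu.-integrable setT (EFin \o normal_pdf x 1) by exact: integrable_normal_pdf.
have izpdf : mu.-integrable setT (EFin \o (fun t => peak^-1 * phi x * normal_pdf x 1 t)).
  rewrite (_ : _ \o _ = (fun t => (peak^-1 * phi x)%:E * (EFin \o normal_pdf x 1) t)%E).
    exact: integrableZl.
  exact/funext.
have ik : mu.-integrable A (EFin \o k) by exact: integrableS integrable_k.
have := @le_normr_Rintegral _ _ _ mu A k mA ik; move/le_trans; apply.
apply: (@le_trans _ _ (\int[mu]_(t in A) (peak^-1 * phi x * normal_pdf x 1 t))).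
  apply: le_Rintegral => //.
  - exact: integrable_norm.
  - exact: integrableS izpdf.
  - by move=> t At; apply: (le_trans (k_le t)); exact/std_normal_pdf_tail/HA.
apply: (@le_trans _ _ (\int[mu]_t (peak^-1 * phi x * normal_pdf x 1 t))).
  rewrite -(setUv A) (@Rintegral_setU _ _ _ mu A (~` A))//.
  - rewrite lerDl; apply: Rintegral_ge0 => t _.
    by rewrite !mulr_ge0 ?invr_ge0 ?normal_peak_ge0 ?normal_pdf_ge0.
  - exact: measurableC.
  - by rewrite setUv.
  - by apply/disj_setPS => t [].
rewrite RintegralZl//.
by rewrite /Rintegral integral_normal_pdf mulr1.
Qed.

Let G_le x : `|G x| <= peak^-1 * phi x.
Proof.
have [x0|x0] := leP x 0.
  by apply: tail_bound => // t; rewrite /= in_itv/= => tx; rewrite mulr_le0_ge0// subr_ge0.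
have GE : G x = - \int[mu]_(t in `]x, +oo[) k t.
  have TE : [set: R] = `]-oo, x] `|` `]x, +oo[ by rewrite -itv_bndbnd_setU// set_itvE.
  apply/eqP; rewrite -addr_eq0 -integral_k TE Rintegral_setU// -?TE//.
  by apply/disj_setPS => t []/=; rewrite !in_itv/= andbT => tx; rewrite ltNge tx.
rewrite GE normrN; apply: tail_bound => // t; rewrite /= in_itv/= andbT => tx.
by rewrite mulr_ge0_le0 ?(ltW x0)// subr_le0 ltW.
Qed.

(** Variation of constants: as phi' = -x phi, the density is an integrating factor and the Stein
    equation reads (f phi)' = (h - c) phi = k. *)
Let f x := G x / phi x.
Let df x := x * f x + (h x - c).

Let is_derive_f x : is_derive x (1 : R) f (df x).
Proof.
have phi0 : phi x != 0 by rewrite gt_eqF// std_normal_pdf_gt0.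
have d1 := is_derive_std_normal_pdf x.
have d2 := is_derive_G x.
have d3 : is_derive x (1 : R) (fun y => (phi y)^-1) (- (phi x) ^- 2 *: (- x * phi x)).
  exact: is_deriveV.
rewrite /f /df; apply: is_derive_eq.
rewrite /GRing.scale /= /f /k.
by field.
Qed.

Let f_le x : `|f x| <= peak^-1.
Proof.
rewrite /f normrM normfV (gtr0_norm (std_normal_pdf_gt0 x)).
by rewrite ler_pdivrMr ?std_normal_pdf_gt0.
Qed.

Let df_le x : `|df x| <= peak^-1 * `|x| + 1.
Proof.
apply: (le_trans (ler_normD _ _)); apply: lerD => //.
by rewrite normrM mulrC ler_wpM2r.
Qed.

(** [G_le] makes f bounded, so f' = x f + h - c grows at most linearly and f is Lipschitz with a
    linear weight; the product x f costs one more power. The quadratic weight is harmless because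
    the sums it is applied to have second moment 1. *)
Lemma stein_solution : exists (f df : R -> R) (C : R),
  [/\ 0 <= C,
      forall x, is_derive x (1 : R) f (df x),
      forall x, df x - x * f x = h x - \int[mu]_x (h x * phi x) &
      forall x y, `|df x - df y| <= C * (1 + x ^+ 2 + y ^+ 2) * `|x - y| ].
Proof.
have p0 : 0 <= peak^-1 by rewrite invr_ge0 normal_peak_ge0.
have K0 : 0 <= K by have := h_lip 1 0; rewrite subr0 normr1 mulr1; exact: le_trans.
exists f, df, (1 + 3 * peak^-1 + K); split => //.
- lra.
- by move=> x; rewrite /df addrC addKr.
move=> x y.
have f_lip u v : u <= v -> `|f v - f u| <= (1 + peak^-1 * (`|u| + `|v|)) * `|v - u|.
  move=> uv; have [|w + ->] := @MVT_segment _ f df u v uv (fun x _ => is_derive_f x).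
    apply: continuous_subspaceT => z.
    by apply: differentiable_continuous; apply/derivable1_diffP; case: (is_derive_f z).
  rewrite in_itv/= => /andP[uw wv]; rewrite normrM ler_wpM2r//.
  apply: (le_trans (df_le w)); rewrite addrC lerD2l ler_wpM2l//.
  rewrite ler_norml; have := ler_norm v. have : - u <= `|u| by rewrite -normrN ler_norm.
  have := normr_ge0 u; have := normr_ge0 v; lra.
have {}f_lip : `|f x - f y| <= (1 + peak^-1 * (`|x| + `|y|)) * `|x - y|.
  have [xy|/ltW xy] := leP x y.
    by rewrite distrC (distrC x); exact: f_lip.
  by rewrite (addrC `|x|); exact: f_lip.
have -> : df x - df y = (x - y) * f x + y * (f x - f y) + (h x - h y) by rewrite /df; ring.
apply: (@le_trans _ _ (peak^-1 * `|x - y| + `|y| * ((1 + peak^-1 * (`|x| + `|y|)) * `|x - y|)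
    + K * `|x - y|)).
  apply: (le_trans (ler_normD _ _)); apply: lerD => //.
  apply: (le_trans (ler_normD _ _)); apply: lerD; rewrite normrM.
    by rewrite mulrC ler_wpM2r.
  by rewrite ler_wpM2l.
rewrite mulrA -!mulrDl ler_wpM2r//.
rewrite -(real_normK (num_real x)) -(real_normK (num_real y)).
move: (normr_ge0 x) (normr_ge0 y) p0 K0.
move: `|x| `|y| (peak^-1) => X Y p X0 Y0 p0 K0.
have : 0 <= p * (X - Y) ^+ 2 by rewrite mulr_ge0// sqr_ge0.
have : 0 <= (Y - 1) ^+ 2 by rewrite sqr_ge0.
have : 0 <= p * Y ^+ 2 by rewrite mulr_ge0// sqr_ge0.
have : 0 <= p * X ^+ 2 by rewrite mulr_ge0// sqr_ge0.
have : 0 <= K * X ^+ 2 by rewrite mulr_ge0// sqr_ge0.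
have : 0 <= K * Y ^+ 2 by rewrite mulr_ge0// sqr_ge0.
have : 0 <= X ^+ 2 by rewrite sqr_ge0.
nra.
Qed.

End stein_equation.

(** * Independent sums on a finite product space *)

Section product_weights.
Context (R : realType) (T : finType) (n : nat).
Implicit Types (y : n.-tuple T) (i : 'I_n) (F G : n.-tuple T -> R).
Variable p : 'I_n -> T -> R.
Hypothesis p_ge0 : forall i z, 0 <= p i z.
Hypothesis p_sum1 : forall i, \sum_z p i z = 1.

Definition prod_weight y : R := \prod_i p i (tnth y i).

Definition Ex F : R := \sum_y prod_weight y * F y.

Lemma prod_weight_ge0 y : 0 <= prod_weight y.
Proof. exact: prodr_ge0. Qed.

Lemma Ex_cst r : Ex (fun=> r) = r.
Proof.
rewrite /Ex -mulr_suml [X in X * _](_ : _ = 1) ?mul1r//.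
rewrite (reindex (fun f : {ffun 'I_n -> T} => [tuple f i | i < n])) /=; last first.
  exists (fun y => [ffun i => tnth y i]) => [f _|y _].
    by apply/ffunP => i; rewrite ffunE tnth_mktuple.
  by apply: eq_from_tnth => i; rewrite tnth_mktuple ffunE.
rewrite (eq_bigr (fun f : {ffun 'I_n -> T} => \prod_i p i (f i))); last first.
  by move=> f _; apply: eq_bigr => i _; rewrite tnth_mktuple.
by rewrite -(bigA_distr_bigA p) big1.
Qed.

Lemma ExD F G : Ex (fun y => F y + G y) = Ex F + Ex G.
Proof. by rewrite /Ex -big_split; apply: eq_bigr => y _; rewrite mulrDr. Qed.

Lemma ExZ r F : Ex (fun y => r * F y) = r * Ex F.
Proof. by rewrite /Ex mulr_sumr; apply: eq_bigr => y _; rewrite mulrCA. Qed.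

Lemma ExB F G : Ex (fun y => F y - G y) = Ex F - Ex G.
Proof. by rewrite /Ex -sumrB; apply: eq_bigr => y _; rewrite mulrBr. Qed.

Lemma Ex_sum (I : finType) (F : I -> n.-tuple T -> R) :
  Ex (fun y => \sum_i F i y) = \sum_i Ex (F i).
Proof.
by rewrite /Ex exchange_big; apply: eq_bigr => y _; rewrite mulr_sumr.
Qed.

Lemma eq_Ex F G : F =1 G -> Ex F = Ex G.
Proof. by move=> FG; apply: eq_bigr => y _; rewrite FG. Qed.

Lemma le_Ex F G : (forall y, F y <= G y) -> Ex F <= Ex G.
Proof. by move=> FG; apply: ler_sum => y _; rewrite ler_wpM2l ?prod_weight_ge0. Qed.

Lemma norm_Ex F : `|Ex F| <= Ex (fun y => `|F y|).
Proof.
apply: (le_trans (ler_norm_sum _ _ _)); apply: ler_sum => y _.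
by rewrite normrM ger0_norm ?prod_weight_ge0.
Qed.

Definition update i (z : T) y : n.-tuple T :=
  [tuple if j == i then z else tnth y j | j < n].

Lemma prod_weight_update i z y :
  prod_weight y * p i z = prod_weight (update i z y) * p i (tnth y i).
Proof.
rewrite /prod_weight (bigD1 i)//= [in RHS](bigD1 i)//= tnth_mktuple eqxx.
rewrite mulrAC [RHS]mulrAC [p i z * _]mulrC; congr (_ * _).
by apply: eq_bigr => j ji; rewrite tnth_mktuple (negbTE ji).
Qed.

(* The pair (y, z) is exchanged with (update i z y, y_i), which has the same weight. *)
Lemma Ex_resample i F : Ex F = Ex (fun y => \sum_z p i z * F (update i z y)).
Proof.
rewrite /Ex; under [RHS]eq_bigr do rewrite mulr_sumr.
rewrite pair_big/=.
pose swap (x : n.-tuple T * T) := (update i x.2 x.1, tnth x.1 i).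
have swapK : involutive swap.
  move=> [y z]; congr pair; last by rewrite tnth_mktuple eqxx.
  apply: eq_from_tnth => j; rewrite !tnth_mktuple; by case: eqVneq => [->|].
rewrite [RHS](reindex_inj (inv_inj swapK))/=.
rewrite [RHS](eq_bigr (fun x => prod_weight x.1 * p i x.2 * F x.1)); last first.
  move=> [y z] _; rewrite mulrA /swap/= -prod_weight_update.
  by have /(congr1 fst) /= -> := swapK (y, z).
rewrite -(pair_big xpredT xpredT (fun y z => prod_weight y * p i z * F y))/=.
by apply: eq_bigr => y _; rewrite -mulr_suml -mulr_sumr p_sum1 mulr1.
Qed.

(** Invariance under [update i] encodes that [G] ignores coordinate i, so resampling that coordinate
    averages only the factor [u]. *)
Lemma Ex_indep i (u : T -> R) G : (forall y z, G (update i z y) = G y) ->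
  Ex (fun y => u (tnth y i) * G y) = (\sum_z p i z * u z) * Ex G.
Proof.
move=> GE; rewrite (Ex_resample i) -ExZ; apply: eq_Ex => y; rewrite mulr_suml.
by apply: eq_bigr => z _; rewrite tnth_mktuple eqxx GE mulrA.
Qed.

Section centered_sum.
Variable X : 'I_n -> T -> R.
Hypothesis X_centered : forall i, \sum_z p i z * X i z = 0.

Definition rv_sum y : R := \sum_i X i (tnth y i).

Definition sum_variance : R := \sum_i \sum_z p i z * X i z ^+ 2.

Let rest i y : R := rv_sum y - X i (tnth y i).

Let rest_update i z y : rest i (update i z y) = rest i y.
Proof.
rewrite /rest /rv_sum (bigD1 i)//= [in RHS](bigD1 i)//= tnth_mktuple eqxx.
rewrite addrAC subrr [RHS]addrAC subrr; congr (0 + _).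
by apply: eq_bigr => j ji; rewrite tnth_mktuple (negbTE ji).
Qed.

Let Ex_rv_sum (f : R -> R) : Ex (fun y => rv_sum y * f (rv_sum y)) =
  \sum_i Ex (fun y => X i (tnth y i) * (f (rv_sum y) - f (rest i y))).
Proof.
rewrite -Ex_sum.
transitivity (Ex (fun y => \sum_i X i (tnth y i) * f (rv_sum y))).
  by apply: eq_Ex => y; rewrite mulr_suml.
rewrite !Ex_sum; apply: eq_bigr => i _.
under [RHS]eq_Ex do rewrite mulrBr.
rewrite ExB (@Ex_indep i (X i) (fun y => f (rest i y))) ?X_centered ?mul0r ?subr0//.
by move=> y z; rewrite rest_update.
Qed.

Let Ex_sqr_rest i G : (forall y z, G (update i z y) = G y) ->
  Ex (fun y => X i (tnth y i) ^+ 2 * G y) = (\sum_z p i z * X i z ^+ 2) * Ex G.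
Proof. by move=> GE; rewrite -Ex_indep. Qed.

Lemma Ex_rv_sum_sqr : Ex (fun y => rv_sum y ^+ 2) = sum_variance.
Proof.
(* For f the identity, the increment f(S) - f(S - X_i) is X_i itself. *)
rewrite (Ex_rv_sum id); apply: eq_bigr => i _.
rewrite -[RHS]mulr1 -(Ex_cst 1) -Ex_sqr_rest//; apply: eq_Ex => y.
by rewrite /rest opprB addrC subrK mulr1 expr2.
Qed.

Hypothesis variance1 : sum_variance = 1.

(* By independence E[X_i f(S)] = E[X_i (f(S) - f(S - X_i))], and the mean value theorem
   turns the increment into X_i f'(w) with w within delta of S. *)
Lemma stein_bound (f df : R -> R) (C delta : R) :
  0 <= C -> 0 <= delta <= 1 -> (forall i z, `|X i z| <= delta) ->
  (forall x, is_derive x (1 : R) f (df x)) ->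
  (forall x w, `|df x - df w| <= C * (1 + x ^+ 2 + w ^+ 2) * `|x - w|) ->
  `|Ex (fun y => df (rv_sum y) - rv_sum y * f (rv_sum y))|
    <= 20 * C * (delta + n%:R * delta ^+ 3).
Proof.
move=> C0 /andP[d0 d1] X_le fdf df_le.
(* As delta <= 1, both squares are at most 2 x^2 + 2, so the weight is at most 5 (1 + x^2); the
   distance of u and w is at most 2 delta. This gives the 10, which E(1 + S^2) = 2 turns into 20. *)
have df_near x u w : `|u - x| <= delta -> `|w - x| <= delta ->
    `|df u - df w| <= 10 * C * delta * (1 + x ^+ 2).
  move=> ux wx; apply: (le_trans (df_le _ _)).
  have uw : `|u - w| <= 2 * delta.
    by have := ler_distD x u w; rewrite (distrC x); lra.
  have sq_near v : `|v - x| <= delta -> v ^+ 2 <= 2 * x ^+ 2 + 2.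
    rewrite ler_norml => vx; have : 0 <= (v - 2 * x) ^+ 2 by rewrite sqr_ge0.
    have : (v - x) ^+ 2 <= 1 by nra.
    by nra.
  apply: (@le_trans _ _ (C * (1 + (2 * x ^+ 2 + 2) + (2 * x ^+ 2 + 2)) * (2 * delta))).
    apply: ler_pM => //.
      by rewrite mulr_ge0// !addr_ge0// sqr_ge0.
    by rewrite ler_wpM2l// !lerD// sq_near.
  have := sqr_ge0 x; have : 0 <= C * delta by rewrite mulr_ge0.
  by nra.
have ES : Ex (fun y => 1 + rv_sum y ^+ 2) = 2.
  by rewrite ExD Ex_cst Ex_rv_sum_sqr variance1.
pose v i := \sum_z p i z * X i z ^+ 2.
have v_ge0 i : 0 <= v i by apply: sumr_ge0 => z _; rewrite mulr_ge0 ?sqr_ge0.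
have rest_near i y : `|rest i y - rv_sum y| <= delta.
  by rewrite /rest addrC addKr normrN.
have sum_near y : `|rv_sum y - rv_sum y| <= delta by rewrite subrr normr0.
(* The variances v_i sum to 1, so E f'(S) is split into the v_i E f'(S). [E1] replaces f'(S) by f'
   at the independent remainder, where v_i can be moved inside as X_i^2; [E2] compares the outcome
   with the increment of f. The first errors sum to order delta, the second to n delta^3. *)
pose E1 i := v i * Ex (fun y => df (rv_sum y) - df (rest i y)).
pose E2 i := Ex (fun y => X i (tnth y i) ^+ 2 * df (rest i y)
                  - X i (tnth y i) * (f (rv_sum y) - f (rest i y))).
have -> : Ex (fun y => df (rv_sum y) - rv_sum y * f (rv_sum y)) = \sum_i (E1 i + E2 i).
  rewrite ExB Ex_rv_sum -[Ex _]mul1r -variance1 mulr_suml -sumrB.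
  apply: eq_bigr => i _; rewrite /E1 /E2 !ExB Ex_sqr_rest; last first.
    by move=> y z; rewrite rest_update.
  by rewrite /v; ring.
have E1_le i : `|E1 i| <= v i * (20 * C * delta).
  rewrite normrM ger0_norm// ler_wpM2l//.
  apply: (le_trans (norm_Ex _)).
  rewrite (_ : 20 * C * delta = Ex (fun y => 10 * C * delta * (1 + rv_sum y ^+ 2))).
    by apply: le_Ex => y; exact: df_near.
  by rewrite ExZ ES; ring.
have E2_le i : `|E2 i| <= 20 * C * delta ^+ 3.
  apply: (le_trans (norm_Ex _)).
  rewrite (_ : 20 * C * delta ^+ 3 =
      Ex (fun y => delta ^+ 2 * (10 * C * delta * (1 + rv_sum y ^+ 2)))); last first.
    by rewrite ExZ ExZ ES; ring.
  apply: le_Ex => y.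
  have [w wS ->] : exists2 w, `|w - rv_sum y| <= delta &
      f (rv_sum y) - f (rest i y) = df w * X i (tnth y i).
    have fc a b : {within `[a, b], continuous f}.
      apply: continuous_subspaceT => z.
      by apply: differentiable_continuous; apply/derivable1_diffP; case: (fdf z).
    have := rest_near i y; rewrite ler_norml => /andP[r1 r2].
    have [rt|/ltW tr] := leP (rest i y) (rv_sum y).
      have [w + ->] := @MVT_segment _ f df _ _ rt (fun x _ => fdf x) (fc _ _).
      rewrite in_itv/= => /andP[w1 w2]; exists w.
        by rewrite ler_norml; lra.
      by rewrite /rest opprB addrC subrK.
    have [w + E] := @MVT_segment _ f df _ _ tr (fun x _ => fdf x) (fc _ _).
    rewrite in_itv/= => /andP[w1 w2]; exists w.
      by rewrite ler_norml; lra.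
    by rewrite -opprB E -mulrN opprB /rest opprB addrC subrK.
  rewrite (_ : _ - _ = X i (tnth y i) ^+ 2 * (df (rest i y) - df w)); last by ring.
  rewrite normrM normrX; apply: ler_pM => //.
    by rewrite lerXn2r ?nnegrE.
  exact: df_near.
apply: (le_trans (ler_norm_sum _ _ _)).
apply: (@le_trans _ _ (\sum_(i < n) (v i * (20 * C * delta) + 20 * C * delta ^+ 3))).
  apply: ler_sum => i _; apply: (le_trans (ler_normD _ _)); exact: lerD.
rewrite big_split/= -mulr_suml (_ : \sum_(i < n) v i = 1)//.
rewrite sumr_const card_ord -[_ *+ n]mulr_natr mul1r.
by rewrite le_eqVlt; apply/orP; left; apply/eqP; ring.
Qed.

End centered_sum.
End product_weights.

(** * Normal approximation *)

Section normal_cdf.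
Context (R : realType).
Notation mu := (@lebesgue_measure R).
Local Notation phi := (@normal_pdf R 0 1).
Local Notation peak := (@normal_peak R 1).

Definition std_normal_cdf (x : R) : R := fine (normal_prob 0 1 `]-oo, x]).

Lemma std_normal_cdfE x : std_normal_cdf x = \int[mu]_(t in `]-oo, x]) phi t.
Proof. by []. Qed.

Let integrable_phi (A : set R) : measurable A -> mu.-integrable A (EFin \o phi).
Proof. by move=> mA; apply: integrableS (integrable_normal_pdf 0 1). Qed.

Lemma std_normal_cdf_lip x eps : 0 <= eps ->
  std_normal_cdf (x + eps) <= std_normal_cdf x + peak * eps.
Proof.
move=> eps0; rewrite -lerBlDl !std_normal_cdfE Rintegral_itvB ?bnd_simp//; last 2 first.
- exact: integrable_phi.
- by rewrite lerDl.
apply: (@le_trans _ _ (\int[mu]_(t in `]x, x + eps]) peak)).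
  apply: le_Rintegral => //.
  - exact: integrable_phi.
  - apply: (@integrableS _ _ _ mu `[x, x + eps]) => //.
      by apply: subset_itvr; rewrite bnd_simp.
    apply: continuous_compact_integrable; first exact: segment_compact.
    by apply: continuous_subspaceT => t; exact: cvg_cst.
  - by move=> t _; rewrite normal_pdf_ub ?oner_neq0.
rewrite Rintegral_cst//= lebesgue_measure_itv/= lte_fin.
case: ifP => _; first by rewrite -EFinB/= addrC addKr.
by rewrite mulr0 mulr_ge0// normal_peak_ge0.
Qed.

(** * Lipschitz approximation of the indicator of a half-line *)

Section ramp.
Variables (a eps : R).
Hypothesis eps_gt0 : 0 < eps.

Definition ramp (u : R) : R := Num.max 0 (Num.min 1 ((a + eps - u) / eps)).

Lemma ramp_itv u : 0 <= ramp u <= 1.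
Proof. by rewrite /ramp le_max lexx ge_max ler01 ge_min lexx. Qed.

Lemma ramp_le u : (u <= a)%R%:R <= ramp u.
Proof.
case: (leP u a) => [ua|_] /=; last by have /andP[] := ramp_itv u.
by rewrite /ramp le_max le_min lexx ler_pdivlMr//; apply/orP; right; lra.
Qed.

Lemma ramp_ge u : ramp u <= (u <= a + eps)%R%:R.
Proof.
case: (leP u _) => [_|ua] /=; first by have /andP[] := ramp_itv u.
by rewrite /ramp ge_max lexx ge_min ler_pdivrMr// mul0r; apply/orP; right; lra.
Qed.

Lemma ramp_lip u v : `|ramp u - ramp v| <= eps^-1 * `|u - v|.
Proof.
rewrite /ramp; set s := _ / eps; set t := _ / eps.
have -> : eps^-1 * `|u - v| = `|s - t|.
  rewrite -[X in X * _]gtr0_norm ?invr_gt0// -normrM distrC; congr `|_|.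
  by rewrite /s /t; field; rewrite gt_eqF.
have h5 := ler_norm (s - t); have := ler_norm (t - s); rewrite (distrC t s) => h6.
have clip (z : R) : z <= 0 /\ Num.max 0 (Num.min 1 z) = 0 \/
    0 <= z <= 1 /\ Num.max 0 (Num.min 1 z) = z \/
    1 <= z /\ Num.max 0 (Num.min 1 z) = 1.
  rewrite maxEle minEle; case: (leP 1 z) => z1; first by right; right; rewrite ler01.
  by case: (leP 0 z) => z0; [right; left; rewrite (ltW z1)|left; rewrite (ltW z0)].
rewrite ler_norml.
by have [[? ->]|[[? ->]|[? ->]]] := clip s; have [[? ->]|[[? ->]|[? ->]]] := clip t; lra.
Qed.

Let integrable_rampM : mu.-integrable setT (EFin \o (fun t => ramp t * phi t)).
Proof.
apply: (le_integrable _ _ _ (integrable_phi measurableT)) => //.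
  apply/measurable_EFinP; apply: measurable_funM; last exact: measurable_normal_pdf.
  apply: measurable_maxr => //; apply: measurable_minr => //.
  by apply: measurable_funM => //; apply: measurable_funB.
move=> x _; rewrite /= lee_fin normrM ler_piMl//.
by have /andP[h0 h1] := ramp_itv x; rewrite ger0_norm.
Qed.

Let cdf_indic b : std_normal_cdf b = \int[mu]_t ((t <= b)%R%:R * phi t).
Proof.
rewrite std_normal_cdfE Rintegral_mkcond; apply: eq_Rintegral => t _.
rewrite patchE; case: ifPn; first by rewrite inE/= in_itv/= => ->; rewrite mul1r.
by rewrite notin_setE/= in_itv/= => /negP/negbTE ->; rewrite mul0r.
Qed.

Let integrable_indic b : mu.-integrable setT (EFin \o (fun t => (t <= b)%R%:R * phi t)).
Proof.
rewrite (_ : _ \o _ = (EFin \o phi) \_ `]-oo, b]).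
  by rewrite -integrable_mkcond//; exact: integrable_phi.
apply/funext => t; rewrite patchE /=; case: ifPn.
  by rewrite inE/= in_itv/= => ->; rewrite mul1r.
by rewrite notin_setE/= in_itv/= => /negP/negbTE ->; rewrite mul0r.
Qed.

Lemma integral_ramp :
  std_normal_cdf a <= \int[mu]_t (ramp t * phi t) <= std_normal_cdf (a + eps).
Proof.
rewrite !cdf_indic; apply/andP; split; apply: le_Rintegral => // t _;
  by rewrite ler_wpM2r ?normal_pdf_ge0// (ramp_le, ramp_ge).
Qed.

End ramp.

(** [C] is fixed before the space, the weights and the summands; this uniformity is what lets the
    law vary with N. *)
Definition normal_approx (x eps C : R) : Prop :=
  forall (T : finType) (n : nat) (p : 'I_n -> T -> R),
    (forall i z, 0 <= p i z) -> (forall i, \sum_z p i z = 1) ->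
  forall X : 'I_n -> T -> R,
    (forall i, \sum_z p i z * X i z = 0) -> sum_variance p X = 1 ->
  forall delta : R, 0 <= delta <= 1 -> (forall i z, `|X i z| <= delta) ->
  `|Ex p (fun y => (rv_sum X y <= x)%R%:R) - std_normal_cdf x|
     <= peak * eps + C * (delta + n%:R * delta ^+ 3).

(** The indicator of u <= x lies between the ramps starting at x - eps and at x. Each ramp is
    handled by its own Stein solution, and [peak * eps] is the change of the normal c.d.f. across a
    ramp. *)
Lemma central_limit_bound (x eps : R) : 0 < eps ->
  exists2 C : R, 0 <= C & normal_approx x eps C.
Proof.
move=> eps0.
have smooth a : exists2 C : R, 0 <= C &
    forall (T : finType) (n : nat) (p : 'I_n -> T -> R),
      (forall i z, 0 <= p i z) -> (forall i, \sum_z p i z = 1) ->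
    forall X : 'I_n -> T -> R,
      (forall i, \sum_z p i z * X i z = 0) -> sum_variance p X = 1 ->
    forall delta : R, 0 <= delta <= 1 -> (forall i z, `|X i z| <= delta) ->
    `|Ex p (fun y => ramp a eps (rv_sum X y)) - \int[mu]_t (ramp a eps t * phi t)|
       <= C * (delta + n%:R * delta ^+ 3).
  have [f [df [C [C0 fdf dfE df_le]]]] :=
    stein_solution (@ramp_itv a eps) (@ramp_lip a eps eps0).
  exists (20 * C) => [|T n p p0 p1 X X0 X1 delta d01 Xd]; first by rewrite mulr_ge0.
  have := stein_bound p0 p1 X0 X1 C0 d01 Xd fdf df_le.
  congr (`|_| <= _).
  by under eq_Ex do rewrite dfE; rewrite ExB Ex_cst.
have [C1 C10 H1] := smooth x; have [C2 C20 H2] := smooth (x - eps).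
exists (C1 + C2) => [|T n p p0 p1 X X0 X1 delta d01 Xd]; first exact: addr_ge0.
have {}H1 := H1 _ _ _ p0 p1 _ X0 X1 _ d01 Xd.
have {}H2 := H2 _ _ _ p0 p1 _ X0 X1 _ d01 Xd.
have le1 : Ex p (fun y => (rv_sum X y <= x)%R%:R) <= Ex p (fun y => ramp x eps (rv_sum X y)).
  by apply: le_Ex => // y; exact: ramp_le.
have le2 : Ex p (fun y => ramp (x - eps) eps (rv_sum X y))
    <= Ex p (fun y => (rv_sum X y <= x)%R%:R).
  by apply: le_Ex => // y; have := ramp_ge (x - eps) eps0 (rv_sum X y); rewrite subrK.
have /andP[_ i1] := integral_ramp x eps0.
have /andP[i2 _] := integral_ramp (x - eps) eps0.
have l1 := std_normal_cdf_lip x (ltW eps0).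
have := std_normal_cdf_lip (x - eps) (ltW eps0); rewrite subrK => l2.
have r0 : 0 <= delta + n%:R * delta ^+ 3.
  by case/andP: d01 => d0 _; rewrite addr_ge0// mulr_ge0// exprn_ge0.
have m1 : 0 <= C1 * (delta + n%:R * delta ^+ 3) by rewrite mulr_ge0.
have m2 : 0 <= C2 * (delta + n%:R * delta ^+ 3) by rewrite mulr_ge0.
move: H1 H2; rewrite mulrDl.
rewrite !ler_norml => /andP[h1 h2] /andP[h3 h4]; apply/andP; split; lra.
Qed.

End normal_cdf.

(** * Linear programming duality *)

Section finite_support.
Context (R : realType) d (B : measurableType d).

Lemma finite_support_probability n (w : 'I_n -> R) (x : 'I_n -> B) :
    (forall k, 0 <= w k) -> \sum_k w k = 1 ->
  exists2 Q : probability B R,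
    (forall A, Q A = \sum_k (w k)%:E * \d_(x k) A)%E &
    forall f : B -> R, measurable_fun setT f -> (forall z, 0 <= f z) ->
      (\int[Q]_z (f z)%:E = (\sum_k w k * f (x k))%:E)%E.
Proof.
case: n w x => [w x _ /eqP|n w x w0 w1]; first by rewrite big_ord0 eq_sym oner_eq0.
(* [msum] sums a family indexed by natural numbers, hence [inord]; the index type is nonempty
   because n = 0 is excluded by the weights summing to 1. *)
pose m k := mscale (NngNum (w0 (inord k))) (dirac (x (inord k))).
have mE A : (msum m n.+1 A = \sum_k (w k)%:E * \d_(x k) A)%E.
  by rewrite /msum; apply: eq_bigr => k _; rewrite /m /mscale /= inord_val.
have mT : (msum m n.+1 [set: B] = 1)%E.
  rewrite mE (eq_bigr (fun k => (w k)%:E)) => [|k _]; last by rewrite diracT mule1.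
  by rewrite sumEFin w1.
pose Q : probability B R :=
  HB.pack (msum m n.+1) (Measure_isProbability.Build _ _ _ (msum m n.+1) mT).
exists Q => [A|f mf f0]; first exact: mE.
have mEf : measurable_fun [set: B] (EFin \o f) by exact/measurable_EFinP.
have f0' z : [set: B] z -> (0 <= (f z)%:E)%E by move=> _; rewrite lee_fin.
transitivity (\int[msum m n.+1]_z (f z)%:E)%E; first by [].
rewrite ge0_integral_measure_sum// -sumEFin; apply: eq_bigr => k _.
rewrite /m ge0_integral_mscale//= integral_dirac//= inord_val.
by rewrite diracT mul1e.
Qed.

Lemma integral_finite_support n (w : 'I_n -> R) (x : 'I_n -> B) (Q : probability B R)
    (f : B -> R) :
    (forall k, 0 <= w k) -> \sum_k w k = 1 ->
    (forall A, measurable A -> Q A = \sum_k (w k)%:E * \d_(x k) A)%E ->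
    measurable_fun setT f -> (forall z, 0 <= f z) ->
  (\int[Q]_z (f z)%:E = (\sum_k w k * f (x k))%:E)%E.
Proof.
move=> w0 w1 QE mf f0; have [Q' Q'E <-//] := finite_support_probability x w0 w1.
by apply: eq_measure_integral => A mA _; exact: etrans (QE A mA) (esym (Q'E A)).
Qed.

End finite_support.

Section duality.
Context (R : realType) dB (B : measurableType dB) (J T : nat).
Variables (s : choice_kernel R B J T) (g : B -> R).
Hypothesis g_measurable : measurable_fun [set: B] g.
Hypothesis g_itv : forall beta, 0 <= g beta <= 1.

Lemma measurable_t_fun (o : seq (cell J T)) l : measurable_fun [set: B] (t_fun s o l).
Proof. exact: measurable_kernel_prob. Qed.

Lemma t_fun_itv (o : seq (cell J T)) l beta : 0 <= t_fun s o l beta <= 1.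
Proof. exact: kernel_itv. Qed.

(** * Dual solution attached to an optimal nondegenerate support *)

Section simplex.
Variables (N : nat) (a : design J T N) (o : seq (cell J T)).
Variable P : probability (profile J T N) R.
Variables (Q : probability B R) (q : 'I_(ndim s o + 1) -> R) (x : 'I_(ndim s o + 1) -> B).
Let L := ndim s o.
Let bP := bvec s a o P.
Hypothesis Q_feasible : primal_feasible s o bP Q.
Hypothesis Q_max : forall Q', primal_feasible s o bP Q' ->
  (\int[Q']_beta (g beta)%:E <= \int[Q]_beta (g beta)%:E)%E.
Hypothesis q_gt0 : forall l, 0 < q l.
Hypothesis q_sum1 : \sum_l q l = 1.
Hypothesis QE : forall A, measurable A -> (Q A = \sum_l (q l)%:E * \d_(x l) A)%E.
Let Mx : 'M[R]_(L + 1) :=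
  col_mx (\matrix_(l < L, k < L + 1) t_fun s o l (x k)) (const_mx 1 : 'rV[R]_(L + 1)).
Hypothesis rank_Mx : \rank Mx = (L + 1)%N.

Let Mx_unit : Mx \in unitmx.
Proof. by rewrite -row_full_unit /row_full rank_Mx eqxx. Qed.

Let integral_Q (f : B -> R) : measurable_fun [set: B] f -> (forall z, 0 <= f z) ->
  (\int[Q]_z (f z)%:E = (\sum_k q k * f (x k))%:E)%E.
Proof. by apply: integral_finite_support => // k; exact: ltW. Qed.

Let g_ge0 z : 0 <= g z. Proof. by have /andP[] := g_itv z. Qed.
Let t_ge0 l z : 0 <= t_fun s o l z. Proof. by have /andP[] := t_fun_itv o l z. Qed.

Let bE (l : 'I_L) : bP 0 l = \sum_k q k * t_fun s o l (x k).
Proof.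
have := Q_feasible l; rewrite integral_Q//; first by move/eqP; rewrite eqe => /eqP.
exact: measurable_t_fun.
Qed.

Let prow (p : 'rV[R]_L * R) : 'rV[R]_(L + 1) := row_mx p.1 (const_mx p.2).

Let prow_mul p k : (prow p *m Mx) 0 k = affine_comb s o p (x k).
Proof.
rewrite mul_row_col !mxE /affine_comb; congr (_ + _).
  by apply: eq_bigr => l _; rewrite mxE.
by rewrite big_ord1 !mxE mulr1.
Qed.

(** Feasibility of Q makes b the q-average of the moments at the support points. In this form,
    comparing dual objectives reduces to comparing affine functions at those points. *)
Let objective p : dotv p.1 bP + p.2 = \sum_k q k * affine_comb s o p (x k).
Proof.
rewrite /dotv /affine_comb.
under [RHS]eq_bigr do rewrite mulrDr mulr_sumr.
rewrite big_split/= -mulr_suml q_sum1 mul1r; congr (_ + _).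
rewrite exchange_big/=; apply: eq_bigr => l _; rewrite bE mulr_sumr.
by apply: eq_bigr => k _; rewrite mulrCA.
Qed.

Let grow : 'rV[R]_(L + 1) := \row_k g (x k).
Let sol : 'rV[R]_(L + 1) := grow *m invmx Mx.
Let p0 : 'rV[R]_L * R := (lsubmx sol, rsubmx sol 0 0).

Let prow_p0 : prow p0 = sol.
Proof.
rewrite /prow /p0/= -[RHS]hsubmxK; congr row_mx.
by apply/rowP => i; rewrite mxE ord1.
Qed.

Let p0_g k : affine_comb s o p0 (x k) = g (x k).
Proof. by rewrite -prow_mul prow_p0 mulmxKV// mxE. Qed.

(* If the dual constraint failed at beta, moving mass epsilon from the support points
   of Q to beta, along the barycentric coordinates c of beta, would keep the moments
   and raise the objective. *)
Let p0_feasible : dual_feasible s g o p0.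
Proof.
move=> beta; rewrite leNgt; apply/negP => gt_g.
pose tau : 'cV[R]_(L + 1) := col_mx (\col_l t_fun s o l beta) (const_mx 1).
pose c := invmx Mx *m tau.
have Mc : Mx *m c = tau by rewrite mulKVmx.
have c_t (l : 'I_L) : \sum_k c k 0 * t_fun s o l (x k) = t_fun s o l beta.
  have := congr1 (fun A : 'cV_(L + 1) => A (lshift 1 l) 0) Mc.
  rewrite mxE col_mxEu mxE => <-; apply: eq_bigr => k _.
  by rewrite mulrC; congr (_ * _); rewrite /Mx col_mxEu mxE.
have c_1 : \sum_k c k 0 = 1.
  have := congr1 (fun A : 'cV_(L + 1) => A (rshift L 0) 0) Mc.
  rewrite mxE col_mxEd mxE => <-; apply: eq_bigr => k _.
  by rewrite -[LHS]mul1r; congr (_ * _); rewrite /Mx col_mxEd mxE.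
have c_g : \sum_k c k 0 * g (x k) = affine_comb s o p0 beta.
  under eq_bigr do rewrite -p0_g /affine_comb mulrDr mulr_sumr.
  rewrite big_split/= -mulr_suml c_1 mul1r; congr (_ + _).
  rewrite exchange_big/=; apply: eq_bigr => l _; rewrite -c_t mulr_sumr.
  by apply: eq_bigr => k _; rewrite mulrCA.
(* The coordinates c may have either sign and exceed 1. This step satisfies eps |c_k| <= q_k for all
   k at once, so the new masses stay nonnegative; the 1 keeps the denominator positive. *)
pose eps := (1 + \sum_k `|c k 0| / q k)^-1.
have den_gt0 : 0 < 1 + \sum_k `|c k 0| / q k.
  by rewrite ltr_pwDl// sumr_ge0// => k _; rewrite divr_ge0// ltW.
have eps_gt0 : 0 < eps by rewrite invr_gt0.
have eps_c k : eps * c k 0 <= q k.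
  apply: (@le_trans _ _ (eps * `|c k 0|)).
    by rewrite ler_wpM2l ?(ltW eps_gt0)// ler_norm.
  rewrite /eps mulrC ler_pdivrMr// mulrC -ler_pdivrMr//.
  rewrite (bigD1 k)//= addrCA lerDl addr_ge0// sumr_ge0// => j _.
  by rewrite divr_ge0// ltW.
(* Index 0 carries the new point beta, the other indices the old support. *)
pose w (k : 'I_(L + 1).+1) := if unlift ord0 k is Some j then q j - eps * c j 0 else eps.
pose z (k : 'I_(L + 1).+1) := if unlift ord0 k is Some j then x j else beta.
have w_sum (f : B -> R) : \sum_k w k * f (z k) =
    eps * f beta + (\sum_k q k * f (x k) - eps * \sum_k c k 0 * f (x k)).
  rewrite big_ord_recl /w /z unlift_none; congr (_ + _).
  rewrite mulr_sumr -sumrB; apply: eq_bigr => k _; rewrite liftK.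
  by rewrite mulrBl mulrA.
have w_ge0 k : 0 <= w k.
  rewrite /w; case: unliftP => [j _|_]; last exact: ltW.
  by rewrite subr_ge0.
have w_1 : \sum_k w k = 1.
  transitivity (\sum_k w k * 1); first by apply: eq_bigr => k _; rewrite mulr1.
  by rewrite (w_sum (fun=> 1)) -!mulr_suml q_sum1 c_1; ring.
have [Q' _ Q'E] := finite_support_probability z w_ge0 w_1.
have /Q_max : primal_feasible s o bP Q'.
  move=> l; rewrite Q'E//; last exact: measurable_t_fun.
  by rewrite w_sum c_t -bE; congr EFin; ring.
rewrite Q'E// integral_Q// lee_fin w_sum c_g.
have : 0 < eps * (g beta - affine_comb s o p0 beta) by rewrite mulr_gt0// subr_gt0.
lra.
Qed.

(** Complementary slackness: for another minimizer the gaps to g at the support points are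
    nonnegative and have q-average 0, so they vanish as q > 0. It therefore interpolates g too, and
    invertibility of [Mx] identifies it with [p0]. *)
Lemma simplex_unique_dual_minimizer : unique_dual_minimizer s g a o P p0.
Proof.
have min0 p : dual_feasible s g o p -> dotv p0.1 bP + p0.2 <= dotv p.1 bP + p.2.
  move=> fp; rewrite !objective; apply: ler_sum => k _.
  by rewrite ler_wpM2l ?(ltW (q_gt0 k))// p0_g; exact: fp.
split; first by split.
move=> p [fp /(_ _ p0_feasible) ple].
have pE k : affine_comb s o p (x k) = g (x k).
  apply/eqP; rewrite -subr_eq0.
  have gap_ge0 j : true -> 0 <= q j * (affine_comb s o p (x j) - g (x j)).
    by move=> _; rewrite mulr_ge0 ?(ltW (q_gt0 j))// subr_ge0; exact: fp.
  have : \sum_j q j * (affine_comb s o p (x j) - g (x j)) = 0.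
    apply/eqP; rewrite eq_le sumr_ge0// andbT.
    under eq_bigr do rewrite mulrBr -[in X in _ - X]p0_g.
    by rewrite sumrB -!objective subr_le0.
  move=> /eqP; rewrite psumr_eq0// => /allP/(_ k); rewrite mem_index_enum => /(_ isT).
  by rewrite mulf_eq0 gt_eqF.
have : prow p *m Mx = prow p0 *m Mx by apply/rowP => k; rewrite !prow_mul pE p0_g.
move/(can_inj (mulmxK Mx_unit))/eq_row_mx => [e1 /rowP/(_ 0)].
rewrite !mxE => e2; case: p e1 e2 {fp ple pE} => p1 p2 /= -> ->.
by [].
Qed.

Lemma simplex_primal_value : primal_value s g a o P = (\sum_k q k * g (x k))%:E.
Proof.
rewrite -integral_Q//; apply/eqP; rewrite eq_le; apply/andP; split.
  by apply: ub_ereal_sup => _ [Q' fQ' <-]; exact: Q_max.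
by apply: ereal_sup_ubound; exists Q.
Qed.

End simplex.

Lemma nondegenerate_unique_dual_minimizer N (a : design J T N) o P :
  nondegenerate_law s g a o P -> exists p, unique_dual_minimizer s g a o P p.
Proof.
move=> [Q [q [x [fQ Qmax [q0 q1] QE rk]]]].
by eexists; exact: (simplex_unique_dual_minimizer fQ Qmax q0 q1 QE rk).
Qed.

Lemma nondegenerate_primal_fin N (a : design J T N) o P :
  nondegenerate_law s g a o P -> primal_value s g a o P \is a fin_num.
Proof.
move=> [Q [q [x [fQ Qmax [q0 q1] QE rk]]]].
by rewrite (simplex_primal_value fQ Qmax q0 q1 QE).
Qed.

Lemma nondegenerate_inhabited N (a : design J T N) o P :
  nondegenerate_law s g a o P -> inhabited B.
Proof.
move=> [_ [_ [x _]]]; have n0 : (0 < ndim s o + 1)%N by rewrite addn1.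
by split; exact: x (Ordinal n0).
Qed.

End duality.

(** * Realizable laws *)

Section realizability.
Context (R : realType) dB (B : measurableType dB) (J T : nat).
Variables (s : choice_kernel R B J T).
Implicit Types (Q : probability B R) (m : menu J T) (y : choice_path J T).

Lemma profile_probability_sum N (P : probability (profile J T N) R) A :
  P A = (\sum_(y : profile J T N) P [set y] * (y \in A)%:R%:E)%E.
Proof.
have AE : A = \bigcup_(y in [set` index_enum (profile J T N)]) (A `&` [set y]).
  apply/seteqP; split => [y Ay|y [z _ []]//].
  by exists y => //=; exact: mem_index_enum.
have := congr1 P AE; rewrite measure_fin_bigcup//; last 2 first.
- apply/trivIsetP => i j _ _ ij; apply/seteqP; split => // z [[_ ->] [_ /=/eqP]].
  by rewrite (negbTE ij).
- by move=> i _; exact: measurable_profile.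
move=> ->; rewrite -fsbig_seq ?index_enum_uniq//; apply: eq_bigr => y _.
have [/[!inE] Ay|yA] := boolP (y \in A).
  by rewrite mule1; congr (P _); apply/seteqP; split => [z []|z /= ->].
rewrite mule0 (_ : _ `&` _ = set0) ?measure0//.
by apply/seteqP; split => z // [Az zy]; move/negP: yA; apply; rewrite inE -zy.
Qed.

Definition choice_prob Q m y : R := \int[Q]_beta s beta m y.

Let integrable_kernel Q m y : Q.-integrable setT (EFin \o (fun beta => s beta m y)).
Proof.
apply: (@le_integrable _ _ _ _ _ _ _ (cst 1%:E)) => //.
- exact/measurable_EFinP/measurable_kernel_prob.
- move=> beta _; rewrite /= normr1 lee_fin ger0_norm; by have /andP[] := kernel_itv s beta m y.
- by apply: finite_measure_integrable_cst.
Qed.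

Let integrable_kernelZ Q c m y : Q.-integrable setT (fun beta => (c * s beta m y)%:E).
Proof.
rewrite (_ : (fun x => _) = (fun beta => c%:E * (EFin \o (fun beta => s beta m y)) beta)%E).
  by apply: integrableZl => //; exact: integrable_kernel.
by apply/funext => beta; rewrite /= EFinM.
Qed.

Lemma choice_probE Q m y : (\int[Q]_beta (s beta m y)%:E = (choice_prob Q m y)%:E)%E.
Proof.
rewrite /choice_prob /Rintegral fineK//.
exact: integrable_fin_num (integrable_kernel Q m y).
Qed.

Lemma choice_prob_ge0 Q m y : 0 <= choice_prob Q m y.
Proof. by apply: Rintegral_ge0 => beta _; have /andP[] := kernel_itv s beta m y. Qed.

Lemma choice_prob_off Q m y : y \notin menu_set m -> choice_prob Q m y = 0.
Proof.
move=> ym; rewrite /choice_prob.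
under eq_Rintegral do rewrite kernel_off//.
by rewrite /Rintegral integral0.
Qed.

Let choice_prob_sum (I : finType) (c : I -> R) (f : I -> menu J T * choice_path J T) Q :
  \int[Q]_beta (\sum_i c i * s beta (f i).1 (f i).2) =
  \sum_i c i * choice_prob Q (f i).1 (f i).2.
Proof.
rewrite /Rintegral; under eq_integral do rewrite -sumEFin.
rewrite integral_sum//; last by move=> i; exact: integrable_kernelZ.
under eq_bigr => i _.
  under eq_integral do rewrite EFinM.
  rewrite integralZl//=; last exact: integrable_kernel.
  rewrite choice_probE -EFinM.
  over.
by rewrite sumEFin.
Qed.

Let choice_prob_affine (I : finType) (c : I -> R) (f : I -> menu J T * choice_path J T) c0 Q :
  \int[Q]_beta (\sum_i c i * s beta (f i).1 (f i).2 + c0) =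
  \sum_i c i * choice_prob Q (f i).1 (f i).2 + c0.
Proof.
rewrite RintegralD//.
- by rewrite choice_prob_sum Rintegral_cst// [X in fine X](probability_setT Q) mulr1.
- rewrite (_ : _ \o _ = (fun beta => \sum_i (c i * s beta (f i).1 (f i).2)%:E)%E).
    by apply: integrable_sum => // i _; exact: integrable_kernelZ.
  by apply/funext => beta; rewrite /= sumEFin.
- exact: finite_measure_integrable_cst.
Qed.

Lemma choice_prob_sum1 Q m : \sum_y choice_prob Q m y = 1.
Proof.
have := choice_prob_sum (fun=> 1) (fun y => (m, y)) Q => /=.
under [X in _ = X]eq_bigr do rewrite mul1r.
move=> <-; rewrite [RHS](_ : 1 = \int[Q]_beta 1); last first.
  by rewrite Rintegral_cst// [X in fine X](probability_setT Q) mul1r.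
apply: eq_Rintegral => beta _; rewrite -[RHS](kernel_sum1 s beta m) [RHS]big_mkcond/=.
by apply: eq_bigr => y _; rewrite mul1r; case: ifPn => // /kernel_off ->.
Qed.

Definition choice_weight Q N (a : design J T N) (i : 'I_N) y : R := choice_prob Q (a i) y.

Lemma marginal_choices_weight N (a : design J T N) Q (y : profile J T N) :
  (marginal_choices (full_law s a Q) [set y] = (prod_weight (choice_weight Q a) y)%:E)%E.
Proof.
rewrite marginal_full_lawE /prod_weight -prodEFin; apply: eq_bigr => i _.
by rewrite choice_probE.
Qed.

Section realizable_law.
Variables (N : nat) (a : design J T N) (P : probability (profile J T N) R).
Variable Q : probability B R.
Hypothesis PQ : measure_eq P (marginal_choices (full_law s a Q)).

Lemma realizable_Ex A :
  P A = (Ex (choice_weight Q a) (fun y : profile J T N => (y \in A)%:R))%:E.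
Proof.
rewrite profile_probability_sum /Ex -sumEFin; apply: eq_bigr => y _.
by rewrite EFinM -marginal_choices_weight (PQ (measurable_profile _)).
Qed.

Lemma realizable_margin i y : margin P i y = choice_prob Q (a i) y.
Proof.
rewrite /margin realizable_Ex /=.
transitivity (Ex (choice_weight Q a) (fun z => (tnth z i == y)%:R * 1)).
  apply: eq_Ex => z; rewrite mulr1; congr (_%:R); congr (nat_of_bool _).
  by apply/idP/eqP => [/[!inE]|zy]; [|rewrite inE].
have w1 (j : 'I_N) : \sum_z choice_weight Q a j z = 1 by exact: choice_prob_sum1.
rewrite (@Ex_indep _ _ _ _ w1 i (fun z => (z == y)%:R) (fun=> 1))// Ex_cst// mulr1.
rewrite (bigD1 y)//= eqxx mulr1 big1 ?addr0// => z /negbTE ->.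
by rewrite mulr0.
Qed.

Lemma realizable_choice_freq m y : m \in design_menus a ->
  choice_freq a P m y = choice_prob Q m y.
Proof.
move=> /imsetP[i0 _ mE].
have n0 : (menu_count a m)%:R != 0 :> R.
  rewrite pnatr_eq0 -lt0n; apply/card_gt0P; exists i0.
  by rewrite inE mE.
rewrite /choice_freq (eq_bigr (fun=> choice_prob Q m y)) => [|i /eqP <-].
  rewrite sumr_const -(mulr_natl (choice_prob Q m y)) mulrA.
  rewrite (_ : #|_| = menu_count a m) ?mulVf ?mul1r//.
  by apply: eq_card => i; rewrite inE.
exact: realizable_margin.
Qed.

End realizable_law.

(** * Retained and redundant moments *)

Lemma ndim_le_size (o : seq (cell J T)) : (ndim s o <= size o)%N.
Proof.
rewrite /ndim -subn1 leq_subLR add1n /max_indep.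
apply/bigmax_leqP => S _; apply: (leq_trans (max_card _)).
by rewrite card_option card_ord.
Qed.

Definition nonredundant (o : seq (cell J T)) : {set option 'I_(size o)} :=
  [set k : option 'I_(size o) | if k is Some l then (l < ndim s o)%N else true]%SET.

Lemma nonredundantE (o : seq (cell J T)) : nonredundant o =
  (None |: [set Some (widen_ord (ndim_le_size o) k) | k : 'I_(ndim s o)])%SET.
Proof.
apply/setP => -[k|]; rewrite !inE//=.
apply/idP/imsetP => [kL|[k' _ [->]]]; last exact: (ltn_ord k').
by exists (Ordinal kL) => //; congr Some; exact: val_inj.
Qed.

Let None_notin (o : seq (cell J T)) :
  None \notin [set Some (widen_ord (ndim_le_size o) k) | k : 'I_(ndim s o)]%SET.
Proof. by apply/imsetP => -[]. Qed.

Let widen_Some_inj (o : seq (cell J T)) :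
  injective (fun k => Some (widen_ord (ndim_le_size o) k)).
Proof. by move=> k k' [] /val_inj. Qed.

Lemma sum_nonredundant (o : seq (cell J T)) (F : option 'I_(size o) -> R) :
  \sum_(k in nonredundant o) F k =
  F None + \sum_(k < ndim s o) F (Some (widen_ord (ndim_le_size o) k)).
Proof.
pose emb (k : 'I_(ndim s o)) := Some (widen_ord (ndim_le_size o) k).
pose prj (k : option 'I_(size o)) : option 'I_(ndim s o) :=
  obind (fun l : 'I_(size o) => insub (val l)) k.
have prjK k : prj (emb k) = Some k by rewrite /prj /emb/= valK.
rewrite (bigD1 None) ?inE//=; congr (_ + _).
rewrite (reindex_omap emb prj) => [|[l|]]; rewrite ?inE ?andbF//.
  by apply: eq_bigl => k; rewrite prjK eqxx !inE/= ltn_ord.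
rewrite andbT => lL; rewrite /prj/= insubT/=; congr (Some (Some _)); exact: val_inj.
Qed.

(** The retained family has maximal cardinality, so adding t_l creates a linear relation. Its
    coefficient at t_l is nonzero, otherwise the retained family itself would be dependent, and the
    relation can be solved for t_l. *)
Lemma t_fun_span (o : seq (cell J T)) (l : 'I_(size o)) : inhabited B ->
    lin_indep (moment_fun s (o := o)) (nonredundant o) ->
  in_span s o (t_fun s o l).
Proof.
move=> [beta0] free.
suff [c cE] : exists c : option 'I_(size o) -> R,
    forall beta, t_fun s o l beta = \sum_(k in nonredundant o) c k * moment_fun s k beta.
  exists (\row_k c (Some (widen_ord (ndim_le_size o) k)), c None).
  apply/funext => beta; rewrite cE sum_nonredundant /affine_comb/= mulr1 addrC.
  by congr (_ + _); apply: eq_bigr => k _; rewrite mxE.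
have [lS|lS] := boolP (Some l \in nonredundant o).
  exists (fun k => (k == Some l)%:R) => beta.
  rewrite (bigD1 (Some l))//= eqxx mul1r big1 ?addr0// => k /andP[_ /negbTE ->].
  by rewrite mul0r.
have card_nonred : (max_indep s o <= #|nonredundant o|)%N.
  rewrite nonredundantE cardsU1 None_notin card_imset; last exact: widen_Some_inj.
  rewrite card_ord.
  by rewrite /ndim add1n leqSpred.
have notfree : ~ lin_indep (moment_fun s (o := o)) (Some l |: nonredundant o).
  move=> free1.
  have : (#|Some l |: nonredundant o| <= max_indep s o)%N.
    apply: (@leq_bigmax_cond _ _ (fun S : {set option 'I_(size o)} => #|S|)).
    exact/asboolP.
  by rewrite cardsU1 lS add1n => /leq_trans/(_ card_nonred); rewrite ltnn.
move: notfree => /existsNP[c /not_implyP[c0 /existsNP[k0 /not_implyP[k0S ck0]]]].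
have cl0 : c (Some l) != 0.
  apply/eqP => cl; apply: ck0.
  have := free c; move=> /(_ _)/(_ k0) H.
  move: k0S; rewrite !inE => /orP[/eqP ->//|k0S]; apply: H; last by rewrite inE.
  by move=> beta; rewrite -[RHS](c0 beta) big_setU1//= cl mul0r add0r.
exists (fun k => - c k / c (Some l)) => beta.
apply: (mulfI cl0); rewrite mulr_sumr.
have := c0 beta; rewrite big_setU1//= => /eqP; rewrite addr_eq0 => /eqP ->.
rewrite -sumrN; apply: eq_bigr => k _.
by field.
Qed.

Section realizable_value.
Variables (N : nat) (a : design J T N) (o : seq (cell J T)).
Variable P : probability (profile J T N) R.
Hypothesis o_adm : admissible_ordering s a o.
Hypothesis B0 : inhabited B.

Lemma cell_at_design_menus l : (l < size o)%N -> (cell_at o l).1 \in design_menus a.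
Proof.
case: o_adm => _ oE _ lo; have := mem_nth (point, point) lo.
by rewrite oE inE => /andP[].
Qed.

Lemma realizable_bvec Q (l : 'I_(ndim s o)) :
    measure_eq P (marginal_choices (full_law s a Q)) ->
  bvec s a o P 0 l = choice_prob Q (cell_at o l).1 (cell_at o l).2.
Proof.
move=> PQ; rewrite mxE (realizable_choice_freq PQ)// cell_at_design_menus//.
exact: leq_trans (ltn_ord l) (ndim_le_size o).
Qed.

Lemma realizable_feasible Q : measure_eq P (marginal_choices (full_law s a Q)) ->
  primal_feasible s o (bvec s a o P) Q.
Proof. by move=> PQ l; rewrite (realizable_bvec _ PQ) choice_probE. Qed.

(** Agreement on the retained cells extends to every cell by integrating [t_fun_span], and choices
    off the menu have probability 0 under both laws. Hence Q and Q0 induce the same product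
    weights. *)
Lemma feasible_realizable Q0 Q : measure_eq P (marginal_choices (full_law s a Q0)) ->
    primal_feasible s o (bvec s a o P) Q ->
  measure_eq (marginal_choices (full_law s a Q)) P.
Proof.
case: o_adm => _ oE free PQ0 feas.
have agree0 (l : nat) : (l < ndim s o)%N ->
    choice_prob Q (cell_at o l).1 (cell_at o l).2 =
    choice_prob Q0 (cell_at o l).1 (cell_at o l).2.
  move=> lL; have := feas (Ordinal lL).
  by rewrite (realizable_bvec _ PQ0) /t_fun choice_probE => -[].
have agree l : (l < size o)%N ->
    choice_prob Q (cell_at o l).1 (cell_at o l).2 =
    choice_prob Q0 (cell_at o l).1 (cell_at o l).2.
  move=> lo; have [[c c0] tE] := t_fun_span (Ordinal lo) B0 free; rewrite /= in tE.
  have probE Q' : choice_prob Q' (cell_at o l).1 (cell_at o l).2 =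
      \sum_(k < ndim s o) c 0 k * choice_prob Q' (cell_at o k).1 (cell_at o k).2 + c0.
    rewrite -(choice_prob_affine _ (fun k : 'I_(ndim s o) => cell_at o k)) /choice_prob.
    by apply: eq_Rintegral => beta _; rewrite -[LHS]/(t_fun s o l beta) tE.
  by rewrite !probE; congr (_ + _); apply: eq_bigr => k _; rewrite agree0.
have agree_all i y : choice_prob Q (a i) y = choice_prob Q0 (a i) y.
  have [ya|ya] := boolP (y \in menu_set (a i)); last by rewrite !choice_prob_off.
  have co : (a i, y) \in o by rewrite oE inE /= ya andbT; apply/imsetP; exists i.
  have := agree _ (_ : (index (a i, y) o < size o)%N).
  by rewrite /cell_at nth_index// index_mem => ->.
move=> A _; apply: (etrans _ (esym (realizable_Ex PQ0 A))).
apply: (etrans (@realizable_Ex _ a _ Q _ A)) => //.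
congr EFin; apply: eq_bigr => y _; congr (_ * _).
by apply: eq_bigr => i _; exact: agree_all.
Qed.

Lemma realizable_value g : realizable s a P -> Psi_sup s g a P = primal_value s g a o P.
Proof.
move=> [Q0 PQ0]; rewrite /Psi_sup /primal_value; congr ereal_sup.
apply/seteqP; split => _ [Q /= HQ <-]; exists Q => //=.
- by apply: realizable_feasible => A mA; exact: esym (HQ A mA).
- exact: feasible_realizable PQ0 HQ.
Qed.

End realizable_value.
End realizability.

(** * Scores and empirical frequencies *)

(** The local duality hypothesis covers only laws carried by the menus, so pointwise comparisons are
    available only at profiles of positive weight. *)
Lemma le_Ex_support (R : realType) (T : finType) n (p : 'I_n -> T -> R)
    (F G : n.-tuple T -> R) : (forall i z, 0 <= p i z) ->
    (forall y, prod_weight p y != 0 -> F y <= G y) ->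
  Ex p F <= Ex p G.
Proof.
move=> p0 FG; apply: ler_sum => y _.
have [->|wy] := eqVneq (prod_weight p y) 0; first by rewrite !mul0r.
by rewrite ler_wpM2l ?prod_weight_ge0// FG.
Qed.

Lemma margin_dirac (R : realType) (J T N : nat) (y : profile J T N) i z :
  margin (dirac y : probability (profile J T N) R) i z = (tnth y i == z)%:R.
Proof.
rewrite /margin -[X in fine X]/(\d_y [set x : profile J T N | tnth x i = z]) diracE.
congr (_%:R); congr (nat_of_bool _).
by apply/idP/eqP => [/[!inE]|yz]; [|rewrite inE].
Qed.

Section cell_scores.
Context (R : realType) dB (B : measurableType dB) (J T : nat).
Variables (s : choice_kernel R B J T) (o : seq (cell J T)).
Local Notation L := (ndim s o).
Implicit Types (b lam : 'rV[R]_L) (m : menu J T) (z : choice_path J T).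

Definition cell_variance lam b m : R :=
  \sum_(l < L | (cell_at o l).1 == m) b 0 l * lam 0 l ^+ 2
  - (\sum_(l < L | (cell_at o l).1 == m) b 0 l * lam 0 l) ^+ 2.

(** Share of an individual facing [m] and choosing [z] in the linear form lam . (b' - b), up to the
    factor 1/n_m. Its variance is the bracket of sigma^2, here [cell_variance]. *)
Definition score lam b m z : R :=
  \sum_(l < L | (cell_at o l).1 == m) lam 0 l * ((z == (cell_at o l).2)%:R - b 0 l).

Lemma variance_sumE (M : {set menu J T}) (e : menu J T -> R) b lam :
  variance_sum s o M e b lam = \sum_(m in M) (e m)^-1 * cell_variance lam b m.
Proof. by []. Qed.

Definition l1norm lam : R := \sum_(l < L) `|lam 0 l|.

Lemma l1norm_ge0 lam : 0 <= l1norm lam.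
Proof. exact: sumr_ge0. Qed.

Lemma score_le lam b m z : (forall l, 0 <= b 0 l <= 1) -> `|score lam b m z| <= l1norm lam.
Proof.
move=> b01; apply: (le_trans (ler_norm_sum _ _ _)).
rewrite /l1norm [leRHS](bigID (fun l : 'I_L => (cell_at o l).1 == m))/=.
rewrite ler_wpDr ?sumr_ge0//; apply: ler_sum => l _.
rewrite normrM ler_piMr//; have := b01 l.
by rewrite ler_norml; case: (z == _) => /=; lra.
Qed.

(** Lipschitz constant of [cell_variance] in b. The first sum comes from the linear term; for the
    squared term the difference of the two means is at most zeta times [l1norm] and their sum at
    most 3 times [l1norm]. *)
Definition variance_lip lam : R := \sum_(l < L) lam 0 l ^+ 2 + 3 * l1norm lam ^+ 2.

Lemma variance_lip_ge0 lam : 0 <= variance_lip lam.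
Proof.
by rewrite addr_ge0 ?mulr_ge0 ?sqr_ge0// sumr_ge0// => l _; exact: sqr_ge0.
Qed.

Lemma cell_variance_lip lam b b' m zeta : 0 <= zeta <= 1 ->
    (forall l, 0 <= b 0 l <= 1) -> (forall l, `|b' 0 l - b 0 l| <= zeta) ->
  `|cell_variance lam b' m - cell_variance lam b m| <= zeta * variance_lip lam.
Proof.
move=> /andP[z0 z1] b01 bb'.
have sum_le (F G : 'I_L -> R) : (forall l, 0 <= G l) -> (forall l, `|F l| <= G l) ->
    `|\sum_(l < L | (cell_at o l).1 == m) F l| <= \sum_l G l.
  move=> G0 FG; apply: (le_trans (ler_norm_sum _ _ _)).
  rewrite [leRHS](bigID (fun l : 'I_L => (cell_at o l).1 == m))/=.
  by rewrite ler_wpDr ?sumr_ge0//; apply: ler_sum => l _.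
pose S1 := \sum_(l < L | (cell_at o l).1 == m) b 0 l * lam 0 l.
pose S1' := \sum_(l < L | (cell_at o l).1 == m) b' 0 l * lam 0 l.
have d2 : `|\sum_(l < L | (cell_at o l).1 == m) (b' 0 l * lam 0 l ^+ 2 - b 0 l * lam 0 l ^+ 2)|
    <= zeta * \sum_(l < L) lam 0 l ^+ 2.
  rewrite mulr_sumr; apply: sum_le => l; first by rewrite mulr_ge0 ?sqr_ge0.
  by rewrite -mulrBl normrM [X in _ * X]ger0_norm ?sqr_ge0// ler_wpM2r ?sqr_ge0.
have d1 : `|S1' - S1| <= zeta * l1norm lam.
  rewrite /S1' /S1 -sumrB mulr_sumr; apply: sum_le => l; first by rewrite mulr_ge0.
  by rewrite -mulrBl normrM ler_wpM2r.
have S1_le : `|S1| <= l1norm lam.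
  apply: sum_le => // l; rewrite normrM ler_piMl//.
  by have /andP[b0 b1] := b01 l; rewrite ger0_norm.
have -> : cell_variance lam b' m - cell_variance lam b m =
   \sum_(l < L | (cell_at o l).1 == m) (b' 0 l * lam 0 l ^+ 2 - b 0 l * lam 0 l ^+ 2)
     - (S1' - S1) * (S1' + S1).
  by rewrite /cell_variance sumrB -/S1 -/S1'; ring.
apply: (le_trans (ler_normB _ _)).
rewrite /variance_lip [leRHS]mulrDr; apply: lerD => //; rewrite normrM.
have l0 := l1norm_ge0 lam.
have zl : zeta * l1norm lam <= l1norm lam by rewrite ler_piMl.
have S2_le : `|S1' + S1| <= 3 * l1norm lam.
  have -> : S1' + S1 = (S1' - S1) + 2 * S1 by ring.
  apply: (le_trans (ler_normD _ _)); rewrite normrM ger0_norm//.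
  lra.
apply: (le_trans (ler_pM _ _ d1 S2_le)) => //.
by rewrite le_eqVlt; apply/orP; left; apply/eqP; ring.
Qed.

Section fixed_design.
Variables (N : nat) (a : design J T N) (P : probability (profile J T N) R).
Variable Q : probability B R.
Hypothesis o_adm : admissible_ordering s a o.
Hypothesis PQ : measure_eq P (marginal_choices (full_law s a Q)).

Let b := bvec s a o P.
Let p := choice_weight s Q a.

Let p_ge0 i z : 0 <= p i z. Proof. exact: choice_prob_ge0. Qed.
Let p_sum1 i : \sum_z p i z = 1. Proof. exact: choice_prob_sum1. Qed.

Let bE l : b 0 l = choice_prob s Q (cell_at o l).1 (cell_at o l).2.
Proof. exact: realizable_bvec. Qed.

Lemma bvec_itv l : 0 <= b 0 l <= 1.
Proof.
rewrite bE choice_prob_ge0/= -(choice_prob_sum1 s Q (cell_at o l).1).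
rewrite (bigD1 (cell_at o l).2)//= lerDl sumr_ge0// => z _.
exact: choice_prob_ge0.
Qed.

Lemma score_centered lam m : \sum_z choice_prob s Q m z * score lam b m z = 0.
Proof.
under eq_bigr do rewrite mulr_sumr.
rewrite exchange_big/= big1// => l /eqP lm.
transitivity (lam 0 l * (\sum_z choice_prob s Q m z * (z == (cell_at o l).2)%:R
    - (\sum_z choice_prob s Q m z) * b 0 l)).
  by rewrite mulr_suml -sumrB mulr_sumr; apply: eq_bigr => z _; ring.
rewrite choice_prob_sum1 bE mul1r lm (bigD1 (cell_at o l).2)//= eqxx mulr1.
rewrite big1 ?addr0 ?subrr ?mulr0// => z /negbTE ->.
by rewrite mulr0.
Qed.

Lemma cell_at_inj (l l' : 'I_L) : cell_at o l = cell_at o l' -> l = l'.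
Proof.
case: o_adm => uo _ _ E; apply: val_inj => /=.
have lo (k : 'I_L) : (k < size o)%N by exact: leq_trans (ltn_ord k) (ndim_le_size s o).
have := nth_uniq (point, point) (lo l) (lo l') uo.
by rewrite -/(cell_at o l) -/(cell_at o l') E eqxx => /esym/eqP.
Qed.

Lemma score_variance lam m :
  \sum_z choice_prob s Q m z * score lam b m z ^+ 2 = cell_variance lam b m.
Proof.
pose F z : R := \sum_(l < L | (cell_at o l).1 == m) lam 0 l * (z == (cell_at o l).2)%:R.
pose mean := \sum_(l < L | (cell_at o l).1 == m) b 0 l * lam 0 l.
have scoreE z : score lam b m z = F z - mean.
  by rewrite /score /F /mean -sumrB; apply: eq_bigr => l _; ring.
have EF : \sum_z choice_prob s Q m z * F z = mean.
  have := score_centered lam m.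
  under eq_bigr do rewrite scoreE mulrBr.
  rewrite sumrB -[X in _ - X]mulr_suml choice_prob_sum1 mul1r.
  by move/eqP; rewrite subr_eq0 => /eqP.
(* Distinct retained cells of the same menu have distinct choices, so the cross products of
   indicators vanish. *)
have FF z : F z ^+ 2 = \sum_(l < L | (cell_at o l).1 == m)
    lam 0 l ^+ 2 * (z == (cell_at o l).2)%:R.
  rewrite expr2 {1}/F mulr_suml; apply: eq_bigr => l /eqP lm.
  have [zl|_] := eqVneq z (cell_at o l).2; last by rewrite !mulr0 mul0r.
  rewrite /F (bigD1 l) ?lm//= zl eqxx big1 ?addr0 ?mulr1 ?expr2// => l' /andP[/eqP l'm l'l].
  case: eqP => [E|]; last by rewrite mulr0.
  case/negP: l'l; apply/eqP/cell_at_inj.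
  rewrite [LHS]surjective_pairing [RHS]surjective_pairing.
  by rewrite l'm lm E.
transitivity (\sum_z choice_prob s Q m z * F z ^+ 2 - mean ^+ 2).
  rewrite [X in _ - X](_ : _ = 2 * mean * (\sum_z choice_prob s Q m z * F z)
     - mean ^+ 2 * \sum_z choice_prob s Q m z); last first.
    by rewrite EF choice_prob_sum1; ring.
  move: (mean) scoreE => mu scoreE.
  rewrite !mulr_sumr -!sumrB; apply: eq_bigr => z _; rewrite scoreE; ring.
rewrite /cell_variance -/mean; congr (_ - _).
under eq_bigr do rewrite FF mulr_sumr.
rewrite exchange_big/=; apply: eq_bigr => l /eqP lm.
rewrite (bigD1 (cell_at o l).2)//= eqxx big1 ?addr0 ?mulr1 ?bE ?lm// => z /negbTE ->.
by rewrite !mulr0.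
Qed.

Lemma sum_by_menu (F : menu J T -> R) :
  \sum_i F (a i) = \sum_(m in design_menus a) (menu_count a m)%:R * F m.
Proof.
rewrite (partition_big a (mem (design_menus a)))/=; last first.
  by move=> i _; apply/imsetP; exists i.
apply: eq_bigr => m _; rewrite (eq_bigr (fun=> F m)) => [|i /eqP ->//].
rewrite sumr_const mulr_natl; congr (_ *+ _).
by apply: eq_card => i; rewrite inE.
Qed.

Lemma menu_count_gt0 m : m \in design_menus a -> (0 < menu_count a m)%N.
Proof. by move=> /imsetP[i _ ->]; apply/card_gt0P; exists i; rewrite inE. Qed.

(** An empirical frequency averages indicators over the individuals facing one menu; exchanging the
    sums over cells and individuals yields independent terms. *)
Lemma dotv_bvec_dirac lam (y : profile J T N) :
  dotv lam (bvec s a o (dirac y) - b) =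
  \sum_i (menu_count a (a i))%:R^-1 * score lam b (a i) (tnth y i).
Proof.
rewrite /dotv; under [RHS]eq_bigr do rewrite mulr_sumr big_mkcond.
rewrite exchange_big/=; apply: eq_bigr => l _; rewrite -big_mkcond/=.
have lo : (l < size o)%N := leq_trans (ltn_ord l) (ndim_le_size s o).
have := menu_count_gt0 (cell_at_design_menus o_adm lo).
set m := (cell_at o l).1; set n := menu_count a m => n0.
have mE (i : 'I_N) : (m == a i) = (a i == m) by rewrite eq_sym.
under [RHS]eq_bigl do rewrite mE.
rewrite (eq_bigr (fun i => lam 0 l * (n%:R^-1 * ((tnth y i == (cell_at o l).2)%:R - b 0 l)))).
  rewrite -mulr_sumr -mulr_sumr sumrB mulrBr !mxE -/b; congr (_ * (_ - _)).
    rewrite /choice_freq -/m -/n; congr (_ * _); apply: eq_bigr => i _.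
    exact: margin_dirac.
  rewrite sumr_const (_ : #|_| = n); last by apply: eq_card => i; rewrite inE.
  by rewrite -(mulr_natl (choice_freq _ _ _ _)) mulKf// pnatr_eq0 -lt0n.
by move=> i /eqP ->; rewrite mulrCA.
Qed.

(** Used with r = sqrt(N / V), which gives total variance 1, and with r = 1 and a unit vector for
    [lam], which isolates one coordinate of b' - b. *)
Definition scaled_score r lam (i : 'I_N) z : R :=
  r * ((menu_count a (a i))%:R^-1 * score lam b (a i) z).

Lemma scaled_score_centered r lam i : \sum_z p i z * scaled_score r lam i z = 0.
Proof.
rewrite /scaled_score; under eq_bigr do rewrite mulrCA [X in r * X]mulrCA.
by rewrite -!mulr_sumr score_centered !mulr0.
Qed.

Lemma rv_sum_scaled_score r lam y :
  rv_sum (scaled_score r lam) y = r * dotv lam (bvec s a o (dirac y) - b).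
Proof. by rewrite dotv_bvec_dirac mulr_sumr. Qed.

Lemma sum_variance_scaled_score r lam : sum_variance p (scaled_score r lam) =
  r ^+ 2 * \sum_(m in design_menus a) (menu_count a m)%:R^-1 * cell_variance lam b m.
Proof.
rewrite /sum_variance /scaled_score.
transitivity (\sum_i r ^+ 2 *
    ((menu_count a (a i))%:R^-1 ^+ 2 * cell_variance lam b (a i))).
  apply: eq_bigr => i _; rewrite -score_variance !mulr_sumr.
  by apply: eq_bigr => z _; rewrite /p /choice_weight; ring.
rewrite -mulr_sumr.
rewrite (sum_by_menu (fun m => (menu_count a m)%:R^-1 ^+ 2 * cell_variance lam b m)).
congr (_ * _); apply: eq_bigr => m ma.
have := menu_count_gt0 ma; rewrite -(ltr_nat R) => n0.
by rewrite mulrA; congr (_ * _); field; rewrite gt_eqF.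
Qed.

(** Each coordinate of b' - b is a sum of scores for a unit vector, whose cell variance is at most
    b_l <= 1. *)
Lemma Ex_enorm_sqr :
  Ex p (fun y => enorm (bvec s a o (dirac y) - b) ^+ 2)
    <= L%:R * \sum_(m in design_menus a) (menu_count a m)%:R^-1.
Proof.
have deltaE (l l' : 'I_L) : (delta_mx 0 l : 'rV[R]_L) 0 l' = (l' == l)%:R.
  by rewrite mxE eqxx.
have enormE y : enorm (bvec s a o (dirac y) - b) ^+ 2 =
    \sum_l rv_sum (scaled_score 1 (delta_mx 0 l)) y ^+ 2.
  rewrite /enorm sqr_sqrtr; last by apply: sumr_ge0 => l _; rewrite -expr2 sqr_ge0.
  apply: eq_bigr => l _; rewrite rv_sum_scaled_score mul1r expr2.
  set v := _ - _; suff -> : dotv (delta_mx 0 l) v = v 0 l by [].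
  rewrite /dotv (bigD1 l)//= deltaE eqxx mul1r big1 ?addr0// => l' /negbTE l'l.
  by rewrite deltaE l'l mul0r.
under eq_Ex do rewrite enormE.
rewrite Ex_sum [leRHS](_ : _ = \sum_(l < L) \sum_(m in design_menus a) (menu_count a m)%:R^-1).
  apply: ler_sum => l _.
  rewrite (Ex_rv_sum_sqr p_sum1); last exact: scaled_score_centered.
  rewrite sum_variance_scaled_score expr1n mul1r; apply: ler_sum => m _.
  rewrite ler_piMr ?invr_ge0// /cell_variance.
  apply: (@le_trans _ _ (\sum_(l' < L | (cell_at o l').1 == m)
      b 0 l' * (delta_mx 0 l : 'rV_L) 0 l' ^+ 2)).
    by rewrite lerBlDr lerDl sqr_ge0.
  apply: (@le_trans _ _ (\sum_(l' < L) b 0 l' * (delta_mx 0 l : 'rV_L) 0 l' ^+ 2)).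
    rewrite [leRHS](bigID (fun l' : 'I_L => (cell_at o l').1 == m))/= lerDl.
    by rewrite sumr_ge0// => l' _; rewrite mulr_ge0 ?sqr_ge0//; have /andP[] := bvec_itv l'.
  rewrite (bigD1 l)//= deltaE eqxx expr1n mulr1 big1 ?addr0; last first.
    by move=> l' /negbTE l'l; rewrite deltaE l'l expr0n mulr0.
  by have /andP[] := bvec_itv l.
by rewrite sumr_const card_ord mulr_natl.
Qed.

Lemma bvec_deviation zeta : 0 < zeta ->
  Ex p (fun y => (zeta <= enorm (bvec s a o (dirac y) - b))%R%:R)
    <= L%:R * (\sum_(m in design_menus a) (menu_count a m)%:R^-1) / zeta ^+ 2.
Proof.
move=> z0; rewrite ler_pdivlMr ?exprn_gt0// mulrC; apply: le_trans Ex_enorm_sqr.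
rewrite -ExZ; apply: le_Ex => // y.
case: (leP zeta _) => [zy|_]; last by rewrite mulr0 sqr_ge0.
by rewrite mulr1 lerXn2r// nnegrE ?(ltW z0)// (le_trans (ltW z0)).
Qed.

Lemma support_np_model y : prod_weight p y != 0 -> np_model a (dirac y : probability _ R).
Proof.
move=> wy; rewrite /np_model /= diracE mem_set//= => i.
apply/negPn/negP => yi; case/negP: wy; rewrite /prod_weight (bigD1 i)//=.
by rewrite /p /choice_weight choice_prob_off// mul0r.
Qed.

End fixed_design.
End cell_scores.

(** * The studentized error *)

Lemma ler_indicator (R : realType) (u v : bool) : (u -> v) -> u%:R <= v%:R :> R.
Proof. by case: u v => [] [] // /(_ isT). Qed.

Section studentized_error.
Context (R : realType) dB (B : measurableType dB) (J T : nat).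
Variables (s : choice_kernel R B J T) (g : B -> R) (o : seq (cell J T)).
Variables (N : nat) (a : design J T N) (P : probability (profile J T N) R).
Variable Q : probability B R.
Hypothesis o_adm : admissible_ordering s a o.
Hypothesis B0 : inhabited B.
Hypothesis PQ : measure_eq P (marginal_choices (full_law s a Q)).
Hypothesis N_gt0 : (0 < N)%N.
Hypothesis primal_fin : primal_value s g a o P \is a fin_num.
Variables (p0 : 'rV[R]_(ndim s o) * R) (eta : R).
Hypothesis local_dual : forall Pbar : probability (profile J T N) R, np_model a Pbar ->
  enorm (bvec s a o Pbar - bvec s a o P) < eta ->
  exists pbar, [/\ unique_dual_minimizer s g a o Pbar pbar,
    (primal_value s g a o Pbar - primal_value s g a o P)%E
      = (dotv pbar.1 (bvec s a o Pbar - bvec s a o P))%:E &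
    pbar.1 = p0.1].

Let b := bvec s a o P.
Let lam := p0.1.
Let V := variance_sum s o (design_menus a) (menu_freq R a) b lam.
Hypothesis V_gt0 : 0 < V.
Let inv_freq : R := \sum_(m in design_menus a) (menu_freq R a m)^-1.

Variables (zeta theta : R).
Hypothesis zeta_itv : 0 < zeta <= 1.
Hypothesis zeta_eta : zeta <= eta.
Hypothesis theta_itv : 0 <= theta <= 2^-1.
Hypothesis zeta_theta : inv_freq * (zeta * variance_lip lam) <= theta * V.

Let X := @scaled_score R dB B J T s o N a P (Num.sqrt (N%:R / V)) lam.
Let p := choice_weight s Q a.

Lemma abs_le_enorm n (u : 'rV[R]_n) l : `|u 0 l| <= enorm u.
Proof.
rewrite -[X in X <= _]sqrtr_sqr /enorm ler_wsqrtr//.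
by rewrite /dotv (bigD1 l)//= -expr2 lerDl sumr_ge0// => k _; rewrite -expr2 sqr_ge0.
Qed.

(** Near b the slope stays [lam], so the numerator is exactly lam . (b' - b) and the variance
    changes only through b'. Here rho = sqrt(V' / V), and clearing denominators gives an equality of
    events. *)
Lemma studentized_le (r0 : profile J T N -> R) y : np_model a (dirac y : probability _ R) ->
    enorm (bvec s a o (dirac y) - b) < zeta ->
  exists2 rho, `|rho - 1| <= theta &
    forall x, (studentized s g a o P r0 y <= x) = (rv_sum X y <= x * rho).
Proof.
move=> ynp ynear.
have [pbar [uniq_pbar primalE pbar1]] := local_dual ynp (lt_le_trans ynear zeta_eta).
set b' := bvec s a o (dirac y) in ynear primalE.
pose V' := variance_sum s o (design_menus a) (menu_freq R a) b' lam.
have V'E : sigma2 s g a o (dirac y : probability _ R) = V'.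
  rewrite /sigma2 asboolT; last by exists pbar.
  case: xgetP => [q _ [_ quniq]|/(_ pbar)//].
  by rewrite -(quniq pbar (proj1 uniq_pbar)) pbar1.
have V'V : `|V' - V| <= theta * V.
  apply: le_trans zeta_theta; rewrite /V' /V !variance_sumE -sumrB /inv_freq mulr_suml.
  apply: (le_trans (ler_norm_sum _ _ _)); apply: ler_sum => m _.
  have f0 : 0 <= (menu_freq R a m)^-1 by rewrite invr_ge0 divr_ge0.
  rewrite -mulrBr normrM ger0_norm// ler_wpM2l//.
  apply: cell_variance_lip => [|l|l].
  - by have /andP[/ltW -> ->] := zeta_itv.
  - exact: (bvec_itv o_adm PQ).
  - by have := abs_le_enorm (b' - b) l; rewrite !mxE; move/le_trans; apply; exact: ltW.
(* As theta <= 1/2, V' is at least V / 2; the denominator is nonzero and the default [r0] is not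
   reached. *)
have V'0 : 0 < V'.
  move: V'V; rewrite ler_norml => /andP[]; have /andP[t0 t1] := theta_itv.
  have : theta * V <= 2^-1 * V by rewrite ler_wpM2r// ltW.
  by have := V_gt0; lra.
exists (Num.sqrt (V' / V)) => [|x].
  have : `|V' / V - 1| <= theta.
    rewrite -[X in _ - X](divff (lt0r_neq0 V_gt0)) -mulrBl normrM normfV (gtr0_norm V_gt0).
    by rewrite ler_pdivrMr.
  have q0 : 0 <= V' / V by rewrite divr_ge0// ltW.
  apply: le_trans; have -> : V' / V - 1 = (Num.sqrt (V' / V) - 1) * (Num.sqrt (V' / V) + 1).
    by rewrite -subr_sqr expr1n sqr_sqrtr.
  rewrite normrM ler_peMr//.
  by rewrite ger0_norm ?addr_ge0 ?sqrtr_ge0// lerDr sqrtr_ge0.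
have sV0 : 0 < Num.sqrt V by rewrite sqrtr_gt0.
have sV'0 : 0 < Num.sqrt V' by rewrite sqrtr_gt0.
have num_fin : primal_value s g a o (dirac y : probability _ R) \is a fin_num.
  move: primalE; move: (primal_value s g a o P) primal_fin => [u| |]// _.
  by case: (primal_value _ _ _ _ _).
rewrite /studentized V'E num_fin.
have PsiE : Psi_sup s g a P = primal_value s g a o P.
  by apply: realizable_value => //; exists Q.
rewrite PsiE primal_fin gt_eqF//=.
rewrite -fineB// primalE/= pbar1 -/lam.
rewrite /X (rv_sum_scaled_score P o_adm) -/b -/b' -/lam.
rewrite !sqrtrM ?ler0n ?(ltW V'0)// !sqrtrV ?(ltW V_gt0)//.
by rewrite mulrA ler_pdivrMr// mulrAC mulrA ler_pM2r ?invr_gt0.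
Qed.

(** On the event that b' is within zeta of b, the random threshold [x * rho] is replaced by its
    extreme values; the complement is charged in full. *)
Lemma studentized_cdf (r0 : profile J T N -> R) x :
  Ex p (fun y => (studentized s g a o P r0 y <= x)%R%:R)
    <= Ex p (fun y => (rv_sum X y <= x + `|x| * theta)%R%:R)
       + Ex p (fun y => (zeta <= enorm (bvec s a o (dirac y) - b))%R%:R) /\
  Ex p (fun y => (rv_sum X y <= x - `|x| * theta)%R%:R)
    <= Ex p (fun y => (studentized s g a o P r0 y <= x)%R%:R)
       + Ex p (fun y => (zeta <= enorm (bvec s a o (dirac y) - b))%R%:R).
Proof.
have p_ge0 i z : 0 <= p i z by exact: choice_prob_ge0.
have xrho rho : `|rho - 1| <= theta -> x - `|x| * theta <= x * rho <= x + `|x| * theta.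
  move=> rho1; have -> : x * rho = x + x * (rho - 1) by ring.
  have : `|x * (rho - 1)| <= `|x| * theta by rewrite normrM ler_wpM2l.
  by rewrite ler_norml => /andP[h1 h2]; apply/andP; split; lra.
split; rewrite -ExD; apply: le_Ex_support => // y wy;
  have ynp := support_np_model wy;
  (have [_|ynear] := leP zeta; first by rewrite ler_wpDl// lern1 leq_b1);
  have [rho rho1 ->] := studentized_le r0 ynp ynear;
  have /andP[l1 l2] := xrho _ rho1; rewrite addr0; apply: ler_indicator => /le_trans; exact.
Qed.

Let N_gt0R : 0 < N%:R :> R. Proof. by rewrite ltr0n. Qed.

Let inv_count m : (menu_count a m)%:R^-1 = (menu_freq R a m)^-1 / N%:R.
Proof. by rewrite /menu_freq invf_div mulrAC divff ?mul1r// gt_eqF. Qed.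

Let sum_inv_count : \sum_(m in design_menus a) (menu_count a m)%:R^-1 = inv_freq / N%:R.
Proof. by rewrite /inv_freq mulr_suml; apply: eq_bigr => m _; exact: inv_count. Qed.

Let sum_variance_X : sum_variance p X = 1.
Proof.
rewrite (sum_variance_scaled_score o_adm PQ) sqr_sqrtr; last by rewrite divr_ge0// ltW.
rewrite (_ : \sum_(m in _) _ = V / N%:R).
  by field; rewrite !gt_eqF.
rewrite /V variance_sumE mulr_suml; apply: eq_bigr => m _.
by rewrite inv_count mulrAC.
Qed.

Variables (kappa v0 : R).
Hypothesis kappa_ge : inv_freq <= kappa.
Hypothesis v0_gt0 : 0 < v0.
Hypothesis v0_le : v0 <= V.
(** Product of sqrt(N / v0) for the scale, kappa / N for 1/n_m and [l1norm lam] for a score. [kappa]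
    and [v0] stand in for quantities depending on N. *)
Let delta := kappa * l1norm lam / Num.sqrt v0 / Num.sqrt N%:R.
Hypothesis delta_le1 : delta <= 1.

Let freq_ge0 m : 0 <= (menu_freq R a m)^-1.
Proof. by rewrite invr_ge0 divr_ge0. Qed.

Let kappa_ge0 : 0 <= kappa.
Proof. by apply: le_trans kappa_ge; exact: sumr_ge0. Qed.

Let X_le i z : `|X i z| <= delta.
Proof.
have sN : Num.sqrt N%:R ^+ 2 = N%:R :> R by rewrite sqr_sqrtr// ltW.
have sN0 : 0 < Num.sqrt N%:R :> R by rewrite sqrtr_gt0.
have sv0 : 0 < Num.sqrt v0 by rewrite sqrtr_gt0.
have count_le : (menu_count a (a i))%:R^-1 <= kappa / N%:R.
  rewrite inv_count ler_pM2r ?invr_gt0//; apply: le_trans kappa_ge.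
  rewrite /inv_freq (bigD1 (a i))/=; last by apply/imsetP; exists i.
  by rewrite lerDl sumr_ge0.
have -> : delta = (Num.sqrt N%:R / Num.sqrt v0) * (kappa / N%:R * l1norm lam).
  by rewrite /delta -[X in kappa / X]sN; field; rewrite !gt_eqF.
rewrite /X /scaled_score normrM; apply: ler_pM => //.
  rewrite ger0_norm ?sqrtr_ge0// sqrtrM ?ler0n// sqrtrV ?(ltW V_gt0)//.
  by rewrite ler_wpM2l ?sqrtr_ge0// lef_pV2 ?posrE ?sqrtr_gt0// ler_wsqrtr.
rewrite normrM; apply: ler_pM => //; first by rewrite ger0_norm ?invr_ge0.
by apply: score_le => l; exact: (bvec_itv o_adm PQ).
Qed.

(** The four terms come from the shifted threshold, the width of the ramp, the Stein estimate and
    Chebyshev's inequality. *)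
Lemma studentized_cdf_bound (r0 : profile J T N -> R) x eps C1 C2 :
    0 <= C1 -> 0 <= C2 ->
    normal_approx (x + `|x| * theta) eps C1 -> normal_approx (x - `|x| * theta) eps C2 ->
  `|Ex p (fun y => (studentized s g a o P r0 y <= x)%R%:R) - std_normal_cdf x| <=
    normal_peak 1 * (`|x| * theta) + normal_peak 1 * eps
    + (C1 + C2) * (delta + N%:R * delta ^+ 3)
    + (ndim s o)%:R * kappa / (zeta ^+ 2 * N%:R).
Proof.
move=> C10 C20 H1 H2; have [u1 u2] := studentized_cdf r0 x.
have p_ge0 i z : 0 <= p i z by exact: choice_prob_ge0.
have p_sum1 i : \sum_z p i z = 1 by exact: choice_prob_sum1.
have X0 i : \sum_z p i z * X i z = 0 by exact: (scaled_score_centered o_adm PQ).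
have d0 : 0 <= delta by rewrite !divr_ge0 ?sqrtr_ge0// mulr_ge0// l1norm_ge0.
have d01 : 0 <= delta <= 1 by rewrite d0.
have {}H1 := H1 _ _ _ p_ge0 p_sum1 _ X0 sum_variance_X _ d01 X_le.
have {}H2 := H2 _ _ _ p_ge0 p_sum1 _ X0 sum_variance_X _ d01 X_le.
have /andP[zeta0 _] := zeta_itv.
have dev : Ex p (fun y => (zeta <= enorm (bvec s a o (dirac y) - b))%R%:R)
    <= (ndim s o)%:R * kappa / (zeta ^+ 2 * N%:R).
  apply: (le_trans (bvec_deviation o_adm PQ zeta0)); rewrite sum_inv_count.
  have -> : (ndim s o)%:R * kappa / (zeta ^+ 2 * N%:R) =
      (ndim s o)%:R * (kappa / N%:R) / zeta ^+ 2 by field; rewrite !gt_eqF.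
  by rewrite !(ler_wpM2r, ler_wpM2l) ?invr_ge0 ?sqr_ge0 ?ler0n.
have xt0 : 0 <= `|x| * theta by rewrite mulr_ge0//; case/andP: theta_itv.
have l1 := std_normal_cdf_lip x xt0.
have := std_normal_cdf_lip (x - `|x| * theta) xt0; rewrite subrK => l2.
have r_ge0 : 0 <= delta + N%:R * delta ^+ 3 by rewrite addr_ge0// mulr_ge0// exprn_ge0.
have m1 : 0 <= C1 * (delta + N%:R * delta ^+ 3) by rewrite mulr_ge0.
have m2 : 0 <= C2 * (delta + N%:R * delta ^+ 3) by rewrite mulr_ge0.
move: H1 H2; rewrite mulrDl.
rewrite !ler_norml => /andP[h1 h2] /andP[h3 h4]; apply/andP; split; lra.
Qed.

End studentized_error.

(** * Choice of constants and passage to the limit *)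

Lemma cvg_sum_inv_freq (R : realType) (I : finType) (M : {set I}) (f : nat -> I -> R)
    (e v : I -> R) : (forall m, m \in M -> 0 < e m) ->
    (forall m, m \in M -> f N m @[N --> \oo] --> e m) ->
  \sum_(m in M) (f N m)^-1 * v m @[N --> \oo] --> \sum_(m in M) (e m)^-1 * v m.
Proof.
move=> e0 fe; apply: cvg_big; first exact: add_continuous.
by move=> m mM; apply: cvgMl; apply: cvgV; [rewrite gt_eqF ?e0|exact: fe].
Qed.

Theorem theorem3 (R : realType) (J T : nat)
  (dB : measure_display) (B : measurableType dB)
  (s : choice_kernel R B J T)
  (g : B -> R) (g_measurable : measurable_fun [set: B] g)
  (g_itv : forall beta, 0 <= g beta <= 1)
  (a : forall N : nat, design J T N)
  (o : nat -> seq (cell J T))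
  (o_adm : forall N, (0 < N)%N -> admissible_ordering s (a N) (o N))
  (P : forall N : nat, probability (profile J T N) R)
  (P_np : forall N, (0 < N)%N -> np_model (a N) (P N))
  (dW : nat -> measure_display) (W : forall N : nat, measurableType (dW N))
  (Pr : forall N : nat, probability (W N) R)
  (Y : forall N : nat, {RV (Pr N) >-> profile J T N})
  (Y_law : forall N, (0 < N)%N -> measure_eq (distribution (Pr N) (Y N)) (P N))
  (r0 : forall N : nat, profile J T N -> R)
  (* (1) *)
  (g_span : forall N, (0 < N)%N -> ~ in_span s (o N) g)
  (* (2) *)
  (N0 : nat) (N0_gt0 : (0 < N0)%N) (M : {set menu J T}) (e : menu J T -> R)
  (stable_menus : forall N, (N0 <= N)%N -> design_menus (a N) = M)
  (e_gt0 : forall m, m \in M -> 0 < e m)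
  (stable_freq : forall m, m \in M -> menu_freq R (a N) m @[N --> \oo] --> e m)
  (stable_order : forall N, (N0 <= N)%N -> o N = o N0)
  (* (3) *)
  (N1 : nat) (N1_ge : (N0 <= N1)%N) (b lambda : 'rV[R]_(ndim s (o N0)))
  (stable_dual : forall N, (N1 <= N)%N ->
    forall p, unique_dual_minimizer s g (a N) (o N) (P N) p ->
    forall (l : 'I_(ndim s (o N))) (k : 'I_(ndim s (o N0))), l = k :> nat ->
      bvec s (a N) (o N) (P N) 0 l = b 0 k /\ p.1 0 l = lambda 0 k)
  (* (4) *)
  (N2 : nat) (N2_gt0 : (0 < N2)%N) (eta : R) (eta_gt0 : 0 < eta)
  (local_dual : forall N, (N2 <= N)%N ->
    forall p, unique_dual_minimizer s g (a N) (o N) (P N) p ->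
    forall Pbar : probability (profile J T N) R, np_model (a N) Pbar ->
    let delta := bvec s (a N) (o N) Pbar - bvec s (a N) (o N) (P N) in
    enorm delta < eta ->
    exists pbar, [/\ unique_dual_minimizer s g (a N) (o N) Pbar pbar,
      (primal_value s g (a N) (o N) Pbar - primal_value s g (a N) (o N) (P N))%E
        = (dotv pbar.1 delta)%:E &
      pbar.1 = p.1])
  (* (5) *)
  (variance_gt0 : 0 < variance_sum s (o N0) M e b lambda)
  (* (6) *)
  (N3 : nat) (N3_gt0 : (0 < N3)%N)
  (real_nondeg : forall N, (N3 <= N)%N ->
    realizable s (a N) (P N) /\ nondegenerate_law s g (a N) (o N) (P N)) :
  cvg_in_distribution
    (fun N => distribution (Pr N) (studentized s g (a N) (o N) (P N) (r0 N) \o Y N))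
    (normal_prob 0 1).
Proof.
move=> x _.
pose mu_ N := distribution (Pr N) (studentized s g (a N) (o N) (P N) (r0 N) \o Y N).
change (mu_ N `]-oo, x]%classic @[N --> \oo] --> normal_prob 0 1 `]-oo, x]%classic)%E.
suff cdf_cvg (tau : R) : 0 < tau -> \forall N \near \oo,
    exists2 u : R, mu_ N `]-oo, x]%classic = u%:E & `|u - std_normal_cdf x| <= tau.
  rewrite -[X in _ --> X](@fineK R); last exact: fin_num_measure.
  apply/fine_cvgP; split.
    by apply: filterS (cdf_cvg 1 ltr01) => N [u -> _].
  apply/cvgrPdist_le => tau tau0; apply: filterS (cdf_cvg tau tau0) => N [u /= -> /=].
  by rewrite distrC.
move=> tau0.
pose q : R := normal_peak 1; have q0 : 0 < q by rewrite normal_peak_gt0 ?oner_neq0.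
(* One quarter each goes to the shifted threshold, to the ramp, and to the Stein and Chebyshev terms
   together. *)
have tau4 : 0 < tau / 4 by rewrite divr_gt0.
pose theta := Num.min 2^-1 (tau / 4 / (q * `|x| + 1)).
have qx0 : 0 <= q * `|x| by rewrite mulr_ge0// ltW.
have theta_gt0 : 0 < theta by rewrite lt_min invr_gt0 ltr0n/= divr_gt0// ltr_wpDl.
have theta_le : q * (`|x| * theta) <= tau / 4.
  apply: (@le_trans _ _ ((q * `|x| + 1) * (tau / 4 / (q * `|x| + 1)))); last first.
    by rewrite mulrC divfK// gt_eqF// ltr_wpDl.
  rewrite [leLHS]mulrA; apply: ler_pM; rewrite ?(ltW theta_gt0)//; first by rewrite lerDl.
  by rewrite ge_min lexx orbT.
pose eps := tau / 4 / q; have eps0 : 0 < eps by rewrite divr_gt0.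
have eps_le : q * eps = tau / 4 by rewrite mulrC divfK// gt_eqF.
have [C1 C10 H1] := central_limit_bound (x + `|x| * theta) eps0.
have [C2 C20 H2] := central_limit_bound (x - `|x| * theta) eps0.
set V0 := variance_sum s (o N0) M e b lambda in variance_gt0.
(* Half the limit variance, and below it the limit of the summed inverse frequencies plus 1, bound
   their counterparts at N for all large N. *)
pose v0 := V0 / 2; have v0_gt0 : 0 < v0 by rewrite divr_gt0.
pose kappa : R := \sum_(m in M) (e m)^-1 * 1 + 1.
have kappa_ge0 : 0 <= kappa.
  by rewrite addr_ge0// sumr_ge0// => m mM; rewrite mulr1 invr_ge0 ltW// e_gt0.
have K0 := variance_lip_ge0 lambda.
have kK0 : 0 <= kappa * variance_lip lambda by rewrite mulr_ge0.
(* The bound 1 serves the variance estimate, [eta] the local duality; the last one keeps the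
   variance within a relative error theta. *)
pose zeta := Num.min (Num.min 1 eta) (theta * v0 / (kappa * variance_lip lambda + 1)).
have zeta_gt0 : 0 < zeta.
  by rewrite !lt_min ltr01 eta_gt0/= divr_gt0 ?mulr_gt0// ltr_wpDl.
have zeta_itv : 0 < zeta <= 1 by rewrite zeta_gt0 !ge_min lexx.
have zeta_eta : zeta <= eta by rewrite !ge_min lexx orbT.
have zeta_theta : kappa * (zeta * variance_lip lambda) <= theta * v0.
  rewrite mulrCA; apply: (@le_trans _ _ (theta * v0 / (kappa * variance_lip lambda + 1)
      * (kappa * variance_lip lambda + 1))).
    apply: ler_pM => //; rewrite ?(ltW zeta_gt0)//; last by rewrite lerDl.
    by rewrite !ge_min lexx !orbT.
  by rewrite divfK// gt_eqF// ltr_wpDl.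
pose D := kappa * l1norm lambda / Num.sqrt v0.
have D0 : 0 <= D by rewrite divr_ge0 ?sqrtr_ge0// mulr_ge0// l1norm_ge0.
(* With delta = D / sqrt N, delta + N delta^3 equals (D + D^3) / sqrt N. The Chebyshev term is E2 /
   N, hence at most E2 / sqrt N. *)
pose E1 := (C1 + C2) * (D + D ^+ 3).
have E10 : 0 <= E1 by rewrite mulr_ge0// addr_ge0// exprn_ge0.
pose E2 := (ndim s (o N0))%:R * kappa / zeta ^+ 2.
have E20 : 0 <= E2 by rewrite divr_ge0 ?sqr_ge0// mulr_ge0.
(* Once sqrt N >= A, delta is at most 1 and (E1 + E2) / sqrt N at most tau / 4. *)
pose A := 1 + D + (E1 + E2) / (tau / 4).
have cvg_freq := @cvg_sum_inv_freq R _ M (fun N => menu_freq R (a N)) e.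
have cvg_kappa := cvg_freq (fun=> 1) e_gt0 stable_freq.
have cvg_V := cvg_freq (cell_variance lambda b) e_gt0 stable_freq.
near=> N.
have N1N : (N1 <= N)%N by near: N; exact: nbhs_infty_ge.
have N0N : (N0 <= N)%N := leq_trans N1_ge N1N.
have N2N : (N2 <= N)%N by near: N; exact: nbhs_infty_ge.
have N3N : (N3 <= N)%N by near: N; exact: nbhs_infty_ge.
have N_gt0 : (0 < N)%N := leq_trans N0_gt0 N0N.
have oN := stable_order N N0N.
have menusN := stable_menus N N0N.
have A2N : A ^+ 2 <= N%:R by near: N; exact: nbhs_infty_ger.
have kappaN : \sum_(m in M) (menu_freq R (a N) m)^-1 * 1 <= kappa.
  by near: N; apply: cvgr_le cvg_kappa _ _; rewrite ltrDl.
have V0N : v0 <= \sum_(m in M) (menu_freq R (a N) m)^-1 * cell_variance lambda b m.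
  near: N; apply: cvgr_ge cvg_V _ _; rewrite -variance_sumE -/V0 /v0.
  by rewrite ltr_pdivrMr// ltr_pMr// ltr1n.
have [[Q PQ] nondeg] := real_nondeg N N3N.
have B0 := nondegenerate_inhabited nondeg.
have primal_fin := nondegenerate_primal_fin g_measurable g_itv nondeg.
have [p0 p0_min] := nondegenerate_unique_dual_minimizer g_measurable g_itv nondeg.
have adm := o_adm N N_gt0.
have dual := stable_dual N N1N p0 p0_min.
have locd := local_dual N N2N p0 p0_min.
rewrite /= in locd.
set F := fun y : profile J T N => ((studentized s g (a N) (o N) (P N) (r0 N) y <= x)%R%:R : R).
exists (Ex (choice_weight s Q (a N)) F).
  rewrite /mu_ /distribution /pushforward /=.
  pose S := [set y | studentized s g (a N) (o N) (P N) (r0 N) y <= x].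
  have YE := etrans (Y_law N N_gt0 S (measurable_profile _)) (realizable_Ex PQ S).
  apply: (etrans _ (etrans YE _)).
    by rewrite /distribution /pushforward /=; congr (Pr N _).
  congr EFin; apply: eq_Ex => y; rewrite /F; congr (_%:R); congr (nat_of_bool _).
  by apply/idP/idP; rewrite inE.
rewrite {}/F.
(* The vectors at N have a length depending on [o N], while [b] and [lambda] have that of [o N0];
   generalizing everything dependent lets the orderings be identified before the vectors are
   compared. *)
move: (o N) oN p0 p0_min adm primal_fin dual locd {nondeg}.
move=> _ -> p0 p0_min adm primal_fin dual locd.
have bE : bvec s (a N) (o N0) (P N) = b.
  by apply/rowP => l; have [] := dual l l erefl.
have lamE : p0.1 = lambda by apply/rowP => l; have [] := dual l l erefl.
have VE : variance_sum s (o N0) (design_menus (a N)) (menu_freq R (a N))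
   (bvec s (a N) (o N0) (P N)) p0.1 =
   \sum_(m in M) (menu_freq R (a N) m)^-1 * cell_variance lambda b m.
  by rewrite menusN bE lamE variance_sumE.
have kappaN' : \sum_(m in design_menus (a N)) (menu_freq R (a N) m)^-1 <= kappa.
  by rewrite menusN; under eq_bigr do rewrite -[_^-1]mulr1.
have A0 : 1 <= A by rewrite /A -addrA lerDl addr_ge0// divr_ge0 ?addr_ge0// ltW.
have AN : A <= Num.sqrt N%:R.
  rewrite -(ger0_norm (le_trans ler01 A0)) -sqrtr_sqr.
  by rewrite ler_wsqrtr.
have sN0 : 0 < Num.sqrt N%:R :> R by rewrite (lt_le_trans _ AN)// (lt_le_trans ltr01).
have sNE : Num.sqrt N%:R ^+ 2 = N%:R :> R by rewrite sqr_sqrtr.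
have DN : D / Num.sqrt N%:R <= 1.
  rewrite ler_pdivrMr// mul1r (le_trans _ AN)// /A.
  have : 0 <= (E1 + E2) / (tau / 4) by rewrite divr_ge0 ?addr_ge0// ltW.
  lra.
have EN : (E1 + E2) / Num.sqrt N%:R <= tau / 4.
  rewrite ler_pdivrMr// mulrC -ler_pdivrMr// (le_trans _ AN)// /A.
  lra.
have := @studentized_cdf_bound R dB B J T s g (o N0) N (a N) (P N) Q adm B0 PQ N_gt0
  primal_fin p0 eta locd _ zeta theta zeta_itv zeta_eta _ _ kappa v0 kappaN' v0_gt0 _ _
  (r0 N) x eps C1 C2 C10 C20 H1 H2.
rewrite VE lamE -/D -/q eps_le.
have theta_itv : 0 <= theta <= 2^-1 by rewrite (ltW theta_gt0) ge_min lexx.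
have zt : (\sum_(m in design_menus (a N)) (menu_freq R (a N) m)^-1) *
      (zeta * variance_lip lambda)
    <= theta * \sum_(m in M) (menu_freq R (a N) m)^-1 * cell_variance lambda b m.
  apply: (@le_trans _ _ (kappa * (zeta * variance_lip lambda))).
    by rewrite ler_wpM2r// mulr_ge0// ltW.
  by apply: (le_trans zeta_theta); rewrite ler_wpM2l// ltW.
move=> /(_ (lt_le_trans v0_gt0 V0N) theta_itv zt V0N DN) H.
apply: (le_trans H).
have -> : (C1 + C2) * (D / Num.sqrt N%:R + N%:R * (D / Num.sqrt N%:R) ^+ 3) =
    E1 / Num.sqrt N%:R.
  by rewrite /E1 -[X in D / _ + X * _]sNE; field; rewrite gt_eqF.
have E2N : (ndim s (o N0))%:R * kappa / (zeta ^+ 2 * N%:R) <= E2 / Num.sqrt N%:R.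
  rewrite invfM mulrA -/E2 ler_wpM2l// lef_pV2 ?posrE ?ltr0n// -[leRHS]sNE expr2.
  by rewrite ler_peMl ?(ltW sN0)// (le_trans A0).
move: EN; rewrite mulrDl => EN; lra.
Unshelve. all: by end_near. Qed.
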